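(* Let $(R,\mathfrak{m})$ be a reduced $F$-finite Cohen--Macaulay local ring of prime characteristic $p$ such that the $F$-signature $s(R)$ exists. Then $s(R)=1$ if and only if $R$ is regular.
   Context: All rings are Noetherian. A ring $R$ of prime characteristic $p$ is $F$-finite if the Frobenius map $r\mapsto r^p$ is a finite map. For $R$ reduced local of dimension $d$ and $q=p^e$, $R^{1/q}$ is the ring of $q$-th roots of elements of $R$, regarded as an $R$-module, and $a_{1q}$ is the number of copies of $R$ appearing in a decomposition of $R^{1/q}$ as a direct sum of indecomposable $R$-modules. The $F$-signature of $R$ is $s(R)=\lim_{q\to\infty}\frac{a_{1q}}{q^d}$, provided the limit exists.
   Formalization: The residue field R/m is additionally assumed perfect; with the normalization by q^d the claim fails otherwise, e.g. for k[[x,y]]/(xy) with [k:k^p]=p, where a_{1q}=q and s(R)=1 but R is not regular. *)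

(* Defs.v *)
From HB Require Import structures.
From mathcomp Require Import all_boot all_order all_algebra.
From mathcomp Require Import all_classical all_reals all_analysis.

Set Implicit Arguments.
Unset Strict Implicit.
Unset Printing Implicit Defensive.

Import Order.TTheory GRing.Theory Num.Theory.
Import numFieldNormedType.Exports.

Local Open Scope classical_set_scope.
Local Open Scope ring_scope.

Section Modules.
Context {R : comNzRingType}.
Implicit Types M : lmodType R.

Definition submodule M (N : set M) : Prop :=
  N 0 /\ forall (a : R) (x y : M), N x -> N y -> N (a *: x + y).

Definition span M (xs : seq M) : set M :=
  [set y | exists c : 'I_(size xs) -> R, y = \sum_i c i *: xs`_i].

Definition indecomposable M (N : set M) : Prop :=
  [/\ submodule N, N <> [set 0] &
      forall A B : set M, submodule A -> submodule B ->
        A `&` B = [set 0] -> [set a + b | a in A & b in B] = N ->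
        A = [set 0] \/ B = [set 0]].

Definition internal_direct_sum M n (N : 'I_n -> set M) : Prop :=
  (forall i, submodule (N i)) /\
  forall x : M, exists! y : {ffun 'I_n -> M},
    (forall i, N i (y i)) /\ x = \sum_i y i.

Definition is_copy_of_ring M (N : set M) : Prop :=
  exists f : {linear R^o -> M}, injective f /\ range f = N.

(* Finite decompositions into indecomposables; over a local ring the number of
   summands isomorphic to the ring is the same in all of them. *)
Definition ring_copies M (a : nat) : Prop :=
  exists (n : nat) (N : 'I_n -> set M),
    [/\ internal_direct_sum N, forall i, indecomposable (N i) &
        a = #|[set i | `[< is_copy_of_ring (N i) >]]%SET|].

End Modules.

Section Ideals.
Context {R : comNzRingType}.

Definition ideal (I : set R) : Prop := submodule (I : set R^o).

Definition ideal_gen (xs : seq R) : set R := span (xs : seq R^o).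

Definition noetherian : Prop :=
  forall I : set R, ideal I -> exists xs : seq R, I = ideal_gen xs.

Definition prime_ideal (P : set R) : Prop :=
  [/\ ideal P, ~ P 1 & forall x y, P (x * y) -> P x \/ P y].

Definition maximal_ideal (m : set R) : Prop :=
  [/\ ideal m, ~ m 1 &
      forall I : set R, ideal I -> m `<=` I -> I = m \/ I = setT].

Definition local_ring (m : set R) : Prop :=
  maximal_ideal m /\ forall n : set R, maximal_ideal n -> n = m.

Definition reduced : Prop := forall (x : R) (n : nat), x ^+ n = 0 -> x = 0.

Definition prime_chain (n : nat) (P : 'I_n.+1 -> set R) : Prop :=
  (forall i, prime_ideal (P i)) /\
  (forall i j : 'I_n.+1, (i < j)%N -> P i `<` P j).

Definition krull_dim (d : nat) : Prop :=
  (exists P : 'I_d.+1 -> set R, prime_chain P) /\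
  (forall n (P : 'I_n.+1 -> set R), prime_chain P -> (n <= d)%N).

Definition regular_sequence (xs : seq R) : Prop :=
  (forall i y, (i < size xs)%N ->
     ideal_gen (take i xs) (xs`_i * y) -> ideal_gen (take i xs) y) /\
  ~ ideal_gen xs 1.

Definition depth (m : set R) (t : nat) : Prop :=
  (exists xs : seq R,
     [/\ size xs = t, {in xs, forall x, m x} & regular_sequence xs]) /\
  (forall xs : seq R,
     {in xs, forall x, m x} -> regular_sequence xs -> (size xs <= t)%N).

Definition cohen_macaulay (m : set R) : Prop :=
  exists d, krull_dim d /\ depth m d.

Definition min_number_of_generators (I : set R) (n : nat) : Prop :=
  (exists xs : seq R, size xs = n /\ I = ideal_gen xs) /\
  (forall xs : seq R, I = ideal_gen xs -> (n <= size xs)%N).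

Definition regular_local (m : set R) : Prop :=
  exists d, krull_dim d /\ min_number_of_generators m d.

Definition F_finite (p : nat) : Prop :=
  exists xs : seq R, forall y : R, exists c : 'I_(size xs) -> R,
    y = \sum_i (c i) ^+ p * xs`_i.

(* Surjectivity of Frobenius on the residue field k = R / m.  This is what the
   normalisation of the F-signature by q^d presupposes: R^{1/q} has rank
   [k^{1/q} : k] q^d when R is a domain.  For k imperfect with [k : k^p] = p,
   the node k[[x, y]] / (x y) has d = 1 and a_{1q} = q, so the limit is 1. *)
Definition perfect_residue_field (m : set R) (p : nat) : Prop :=
  forall x : R, exists y : R, m (x - y ^+ p).

End Ideals.

Arguments noetherian : clear implicits.
Arguments reduced : clear implicits.
Arguments krull_dim : clear implicits.
Arguments F_finite : clear implicits.

(* R^{1/q} for q = p ^ e: the element x of R stands for its q-th root x^{1/q},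
   so the ring operations are those of R (Frobenius is additive), while r in R
   is identified with (r^q)^{1/q} and hence scales x^{1/q} to (r^q x)^{1/q}.
   For R reduced, r |-> (r^q)^{1/q} is injective and R is a subring. *)
Definition qroots (R : comNzRingType) (p : nat) (charRp : p \in [pchar R])
  (e : nat) : Type := R.

Section QRoots.
Context (R : comNzRingType) (p : nat) (charRp : p \in [pchar R]) (e : nat).
Local Notation S := (qroots charRp e).

HB.instance Definition _ := GRing.ComNzRing.on S.

Definition qroots_scale (r : R) (x : S) : S := (r ^+ (p ^ e) : R) * (x : R).

Fact qroots_scaleA (a b : R) (x : S) :
  qroots_scale a (qroots_scale b x) = qroots_scale (a * b) x.
Proof. by rewrite /qroots_scale mulrA exprMn. Qed.

Fact qroots_scale1 : left_id 1 qroots_scale.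
Proof. by move=> x; rewrite /qroots_scale expr1n mul1r. Qed.

Fact qroots_scaleDr : right_distributive qroots_scale +%R.
Proof. by move=> a x y; rewrite /qroots_scale mulrDr. Qed.

Fact qroots_scaleDl (x : S) : {morph qroots_scale^~ x : a b / a + b}.
Proof.
move=> a b; rewrite /qroots_scale exprDn_pchar ?mulrDl //.
by rewrite pnatX (eq_pnat _ (pcharf_eq charRp)) pnat_id ?(pcharf_prime charRp).
Qed.

HB.instance Definition _ := GRing.Zmodule_isLmodule.Build R S
  qroots_scaleA qroots_scale1 qroots_scaleDr qroots_scaleDl.

Fact qroots_scaleAl (a : R) (x y : S) : a *: (x * y) = a *: x * y.
Proof. exact: mulrA. Qed.

HB.instance Definition _ := GRing.Lmodule_isLalgebra.Build R S qroots_scaleAl.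

Definition qroot (x : R) : S := x.

Lemma qrootK (x : R) : qroot x ^+ (p ^ e) = x%:A.
Proof. by rewrite -[LHS]mulr1. Qed.

Lemma qroot_surj (y : S) : exists x : R, y = qroot x.
Proof. by exists y. Qed.

End QRoots.

(* s is the limit of a_{1q} / q^d, where a e is a_{1q} for q = p ^ e. *)
Definition is_F_signature (R : comNzRingType) (p : nat)
    (charRp : p \in [pchar R]) (K : realType) (s : K) : Prop :=
  exists (d : nat) (a : nat -> nat),
    [/\ krull_dim R d,
        forall e, ring_copies (qroots charRp e) (a e) &
        (fun e : nat => (a e)%:R / ((p ^ e)%N%:R ^+ d) : K) @ \oo --> s].

(* Main.v *)
(** For [q = p ^ e], submodules of [R^{1/q}] are encoded as subsets of [R]
    stable under multiplication by [q]-th powers, and [I R^{1/q}] as the bracket power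
    [I^[q]]. If [R^{1/q}] has [a] free summands, then
    [len (I^[q] / J^[q]) >= a len (I / J)] for ideals [J <= I]; since the residue
    field is perfect, [len (R / X^[q]) <= q^d len (R / X)] when [X] is generated
    by a regular sequence of length [d].

    If [s(R) = 1], these two bounds make [len (R / m^[q]) / q^d] tend to [1] and
    [len (R / m^[p])] at most [p^d]. Let [y_1, ..., y_n] be minimal generators
    of [m]. A relation [sum b_i y_i^p = 0] with some [b_i] outside [m^[p]] would
    make [len (m^[pq] / (m^2)^[pq])] smaller than [n (pq)^d] by at least about
    [q^d], so there is none, and Lech's argument gives [len (R / m^[p]) >= p^n].
    Hence [n <= d], while [a <= len (R / m^[q]) <= q^n] gives [d <= n].

    If [R] is regular, comparison with a maximal regular sequence gives
    [len (R / m^[q]) = q^d] for all [q]. Every [u] outside [m^[q]] then spans a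
    free direct summand of [R^{1/q}]: a relation would contradict these lengths,
    by Krull's intersection theorem. So each indecomposable summand of
    [R^{1/q}] is free, and there are exactly [q^d] of them. *)
From HB Require Import structures.
Require Import Defs.
From mathcomp Require Import all_boot all_order all_algebra.
From mathcomp Require Import all_classical all_reals all_analysis.
From mathcomp Require Import ring zify.

Set Implicit Arguments.
Unset Strict Implicit.
Unset Printing Implicit Defensive.

Import Order.TTheory GRing.Theory Num.Theory.
Import numFieldNormedType.Exports.

Local Open Scope classical_set_scope.
Local Open Scope ring_scope.

(** * Chains of submodules *)

Section Chains.
Context {R : comNzRingType}.
Implicit Types (q k n : nat) (a b c r u v x y z : R) (A B C I J N : set R)
  (s : seq R).

Definition additive_pow q : Prop := forall a b, (a + b) ^+ q = a ^+ q + b ^+ q.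

(* [N ^ (1/q)] is an [R]-submodule of [R ^ (1/q)]; for [q = 1], an ideal. *)
Definition submod q N : Prop :=
  N 0 /\ forall a x y, N x -> N y -> N (a ^+ q * x + y).

(** In [R^{1/q}] this is [N + R u], a scalar [r] acting as multiplication by [r^q]. *)
Definition adjoin q N u : set R := [set x | exists r, N (x - r ^+ q * u)].

Fixpoint adjoins q N s : set R :=
  if s is u :: s' then adjoins q (adjoin q N u) s' else N.

(* There are [k + 1] submodules [N_0 < ... < N_k] with [B <= N_0] and
   [N_k <= A]. *)
Inductive chain q B : set R -> nat -> Prop :=
| chain0 A : submod q A -> B `<=` A -> chain q B A 0
| chainS A A' k : chain q B A k -> submod q A' -> A `<` A' ->
    chain q B A' k.+1.

(** Length is never a number here: [chain] bounds the length of [A / B] from below and [length_le]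
    from above, which also covers infinite length. *)
Definition length_le q B A n : Prop := forall k, chain q B A k -> (k <= n)%N.

Lemma additive_pow1 : additive_pow 1.
Proof. by []. Qed.

Lemma pow0 q : additive_pow q -> (0 : R) ^+ q = 0.
Proof.
by move=> qD; apply: (addrI ((0 : R) ^+ q)); rewrite -qD !addr0.
Qed.

Lemma powN q : additive_pow q -> forall a, (- a) ^+ q = - a ^+ q.
Proof.
move=> qD a; apply/eqP; rewrite -addr_eq0 -qD addrC subrr.
by rewrite pow0.
Qed.

Lemma powB q : additive_pow q -> forall a b, (a - b) ^+ q = a ^+ q - b ^+ q.
Proof. by move=> qD a b; rewrite qD powN. Qed.

Lemma additive_powM q q' :
  additive_pow q -> additive_pow q' -> additive_pow (q * q').
Proof. by move=> qD qD' a b; rewrite !exprM qD qD'. Qed.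

Section Level.
Context (q : nat) (qD : additive_pow q).

Lemma submod0 N : submod q N -> N 0.
Proof. by case. Qed.

Lemma submodZ N a x : submod q N -> N x -> N (a ^+ q * x).
Proof. by case=> N0 NZD Nx; rewrite -[_ * _]addr0; apply: NZD. Qed.

Lemma submodD N x y : submod q N -> N x -> N y -> N (x + y).
Proof.
by case=> _ NZD Nx Ny; rewrite -[x]mul1r -[1](expr1n _ q); apply: NZD.
Qed.

Lemma submodN N x : submod q N -> N x -> N (- x).
Proof.
move=> Nsub Nx; rewrite -mulN1r -[-1](_ : (-1) ^+ q = _).
  exact: submodZ.
by rewrite powN // expr1n.
Qed.

Lemma submodB N x y : submod q N -> N x -> N y -> N (x - y).
Proof. by move=> Nsub Nx Ny; apply: submodD => //; apply: submodN. Qed.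

Lemma submodBr N x y : submod q N -> N y -> N (x - y) -> N x.
Proof. by move=> Nsub Ny Nxy; rewrite -[x](subrK y); apply: submodD. Qed.

Lemma submod_sum N (I : Type) (l : seq I) (P : pred I) (F : I -> R) :
  submod q N -> (forall i, P i -> N (F i)) -> N (\sum_(i <- l | P i) F i).
Proof.
by move=> Nsub NF; apply: big_ind => //; [exact: submod0 | move=> x y;
  exact: submodD].
Qed.

Lemma submodT : submod q setT.
Proof. by []. Qed.

Lemma submod_0 : submod q [set 0].
Proof. by split=> // a x y /= -> ->; rewrite mulr0 addr0. Qed.

Lemma submodI A B : submod q A -> submod q B -> submod q (A `&` B).
Proof.
move=> [A0 AZD] [B0 BZD]; split=> // a x y [Ax Bx] [Ay By].
by split; [apply: AZD | apply: BZD].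
Qed.

Lemma submod_adjoin N u : submod q N -> submod q (adjoin q N u).
Proof.
move=> Nsub; split; first by exists 0; rewrite pow0 // mul0r subr0;
  exact: submod0.
move=> a x y [r Nr] [t Nt]; exists (a * r + t); rewrite qD exprMn.
rewrite (_ : _ - _ = a ^+ q * (x - r ^+ q * u) + (y - t ^+ q * u));
  last by ring.
by apply: submodD => //; apply: submodZ.
Qed.

Lemma sub_adjoin N u : N `<=` adjoin q N u.
Proof. by move=> x Nx; exists 0; rewrite pow0 // mul0r subr0. Qed.

Lemma mem_adjoin N u : submod q N -> adjoin q N u u.
Proof. by exists 1; rewrite expr1n mul1r subrr; exact: submod0. Qed.

Lemma adjoin_min N A u :
  submod q A -> N `<=` A -> A u -> adjoin q N u `<=` A.
Proof.
by move=> Asub NA Au x [r /NA]; apply: submodBr => //; exact: submodZ.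
Qed.

Lemma adjoinS N N' u : N `<=` N' -> adjoin q N u `<=` adjoin q N' u.
Proof. by move=> NN' x [r /NN']; exists r. Qed.

Lemma adjoin_proper N u : submod q N -> ~ N u -> N `<` adjoin q N u.
Proof.
move=> Nsub Nu; split=> [|uN]; first exact: sub_adjoin.
by apply: Nu; apply: uN; apply: mem_adjoin.
Qed.

Lemma submod_adjoins N s : submod q N -> submod q (adjoins q N s).
Proof. by elim: s N => //= u s IHs N Nsub; apply/IHs/submod_adjoin. Qed.

Lemma sub_adjoins N s : N `<=` adjoins q N s.
Proof.
elim: s N => [|u s IHs] N /=; first exact: subset_refl.
by move=> x Nx; apply: IHs; apply: sub_adjoin.
Qed.

Lemma mem_adjoins N s u : submod q N -> u \in s -> adjoins q N s u.
Proof.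
elim: s N => //= v s IHs N Nsub; rewrite in_cons => /predU1P[->|us].
  by apply: sub_adjoins; apply: mem_adjoin.
by apply: IHs => //; apply: submod_adjoin.
Qed.

Lemma adjoins_min N A s :
  submod q A -> N `<=` A -> {in s, forall u, A u} -> adjoins q N s `<=` A.
Proof.
move=> Asub; elim: s N => //= u s IHs N NA As; apply: IHs.
  by apply: adjoin_min => //; apply: As; rewrite mem_head.
by move=> v vs; apply: As; rewrite in_cons vs orbT.
Qed.

Lemma adjoinsP N s x :
  adjoins q N s x <->
  exists c : 'I_(size s) -> R, N (x - \sum_i c i ^+ q * s`_i).
Proof.
elim: s N x => [|u s IHs] N x /=.
  split=> [Nx|[c]]; last by rewrite big_ord0 subr0.
  by exists (fun=> 0); rewrite big_ord0 subr0.
rewrite IHs; split=> [[c [r Nx]]|[c Nx]].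
  exists (fun i => if unlift ord0 i is Some j then c j else r).
  rewrite big_ord_recl unlift_none; under eq_bigr do rewrite liftK.
  by rewrite opprD addrA addrAC.
exists (fun j => c (lift ord0 j)), (c ord0).
by move: Nx; rewrite big_ord_recl opprD addrA addrAC.
Qed.

Lemma adjoinC N u v :
  adjoin q (adjoin q N u) v = adjoin q (adjoin q N v) u.
Proof. by apply/seteqP; split=> x [r [t Nx]]; exists t, r; rewrite addrAC. Qed.

Lemma adjoins_adjoin N s u :
  adjoins q (adjoin q N u) s = adjoin q (adjoins q N s) u.
Proof. by elim: s N => //= v s IHs N; rewrite adjoinC IHs. Qed.

Lemma adjoinsS N N' s : N `<=` N' -> adjoins q N s `<=` adjoins q N' s.
Proof. by elim: s N N' => //= u s IHs N N' NN'; apply/IHs/adjoinS. Qed.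

Lemma chain_submod B A k : chain q B A k -> submod q A.
Proof. by case. Qed.

Lemma chain_last B A k : chain q B A k.+1 ->
  exists C, [/\ chain q B C k, submod q A & C `<` A].
Proof.
move En: k.+1 => n ch; case: ch En => // C C' k' ch C'sub CC' [->].
by exists C.
Qed.

Lemma chain_sub B A k : chain q B A k -> B `<=` A.
Proof.
by elim=> // {}A A' {}k _ BA _ [AA' _]; apply: subset_trans BA AA'.
Qed.

Lemma chainSr B A A' k :
  chain q B A k -> submod q A' -> A `<=` A' -> chain q B A' k.
Proof.
move=> chA A'sub AA'; case: chA AA' => [C Csub BC|C C' {}k chC C'sub CC'] C'A'.
  by apply: chain0 => //; apply: subset_trans C'A'.
apply: chainS chC A'sub _; case: CC' => CC' nC'C; split.
  exact: subset_trans C'A'.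
by move=> A'C; apply: nC'C; apply: subset_trans A'C.
Qed.

Lemma chainSl B B' A k : chain q B A k -> B' `<=` B -> chain q B' A k.
Proof.
move=> chA B'B; elim: chA => [C Csub BC|C C' {}k _ IH C'sub CC'].
  by apply: chain0 => //; apply: subset_trans BC.
exact: chainS IH C'sub CC'.
Qed.

Lemma chain_cat B C A k l :
  chain q B C k -> chain q C A l -> chain q B A (k + l).
Proof.
move=> chB; elim=> [D Dsub CD|D D' {}l _ IH D'sub DD'].
  by rewrite addn0; apply: chainSr chB _ CD.
by rewrite addnS; apply: chainS IH D'sub DD'.
Qed.

Lemma chain_leq B A k l : (l <= k)%N -> chain q B A k -> chain q B A l.
Proof.
move=> lk ch; elim: ch lk => [C Csub BC|C C' {}k chC IH C'sub CC'].
  by rewrite leqn0 => /eqP ->; apply: chain0.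
rewrite leq_eqVlt => /predU1P[->|/IH ch]; first exact: chainS chC C'sub CC'.
by apply: chainSr ch C'sub CC'.1.
Qed.

Lemma chain_adjoin B u : submod q B -> ~ B u -> chain q B (adjoin q B u) 1.
Proof.
move=> Bsub Bu; apply: chainS (chain0 Bsub (@subset_refl _ _)) _ _.
  exact: submod_adjoin.
exact: adjoin_proper.
Qed.

(* The modular law: at each step of the chain, the trace on [C] or the sum
   with [C] grows. *)
Lemma chain_split B C A k : submod q B -> submod q C -> B `<=` C ->
  chain q B A k -> exists k1 k2,
  [/\ (k <= k1 + k2)%N, chain q B (A `&` C) k1 &
      chain q C [set x | exists y z, [/\ A y, C z & x = y + z]] k2].
Proof.
move=> Bsub Csub BC.
have sumsub D : submod q D ->
    submod q [set x | exists y z, [/\ D y, C z & x = y + z]].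
  move=> Dsub; split; first by exists 0, 0; rewrite addr0; split=> //;
    exact: submod0.
  move=> a _ _ [y [z [Dy Cz ->]]] [y' [z' [Dy' Cz' ->]]].
  exists (a ^+ q * y + y'), (a ^+ q * z + z'); split; last by ring.
    by case: Dsub => _; apply.
  by case: Csub => _; apply.
elim=> [D Dsub BD|D D' {}k chD [k1 [k2 [le_k chI chS]]] D'sub DD'].
  exists 0%N, 0%N; split=> //.
    by apply: chain0; [apply: submodI | move=> x Bx; split;
      [apply: BD | apply: BC]].
  apply: chain0; first exact: sumsub.
  by move=> x Cx; exists 0, x; rewrite add0r; split=> //; exact: submod0.
have [sD nD] := DD'.
have sSum : [set x | exists y z, [/\ D y, C z & x = y + z]] `<=`
            [set x | exists y z, [/\ D' y, C z & x = y + z]].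
  by move=> _ [y [z [Dy Cz ->]]]; exists y, z; split=> //; apply: sD.
have [IE|nIE] := EM (D' `&` C `<=` D `&` C); last first.
  exists k1.+1, k2; split; first by rewrite addSn.
    by apply: chainS chI (submodI D'sub Csub) _; split=> //; apply: setSI.
  exact: chainSr chS (sumsub _ D'sub) sSum.
exists k1, k2.+1; split; first by rewrite addnS.
  by apply: chainSr chI (submodI D'sub Csub) _; apply: setSI.
apply: chainS chS (sumsub _ D'sub) _; split=> // SE; apply: nD => x D'x.
have [|y [z [Dy Cz xE]]] := SE x.
  by exists x, 0; rewrite addr0; split=> //; exact: submod0.
have D'z : D' z.
  rewrite (_ : z = x - y); last by rewrite xE; ring.
  by apply: submodB => //; apply: sD.
have [Dz _] := IE z (conj D'z Cz); rewrite xE.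
by apply: submodD (chain_submod chD) _ _.
Qed.

Lemma length_le_refl B A : submod q B -> A `<=` B -> length_le q B A 0.
Proof.
move=> Bsub AB k ch; case: ch AB => // C C' {}k chC _ [_ nC'C] C'B.
by case: nC'C; apply: subset_trans C'B (chain_sub chC).
Qed.

Lemma length_le_trans B C A n1 n2 : submod q B -> submod q C -> B `<=` C ->
  C `<=` A -> submod q A ->
  length_le q B C n1 -> length_le q C A n2 -> length_le q B A (n1 + n2).
Proof.
move=> Bsub Csub BC CA Asub le1 le2 k ch.
have [k1 [k2 [le_k ch1 ch2]]] := chain_split Bsub Csub BC ch.
apply: leq_trans le_k _; apply: leq_add.
  by apply: le1; apply: chainSr ch1 Csub _; apply: subIsetr.
apply: le2; apply: (chainSr ch2 Asub) => _ [y [z [Ay Cz ->]]].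
by apply: (submodD Asub) => //; apply: CA.
Qed.

Lemma length_leW B A n n' : (n <= n')%N -> length_le q B A n -> length_le q B A n'.
Proof. by move=> nn' le k /le kn; apply: leq_trans nn'. Qed.

Lemma length_leSl B B' A n :
  B `<=` B' -> length_le q B A n -> length_le q B' A n.
Proof. by move=> BB' le k ch; apply: le; apply: chainSl BB'. Qed.

Lemma length_leSr B A A' n :
  submod q A -> A' `<=` A -> length_le q B A n -> length_le q B A' n.
Proof. by move=> Asub A'A le k ch; apply: le; apply: chainSr A'A. Qed.

(** This takes the place of subtracting lengths: a lower bound below [C] improves the upper bound
    above it. *)
Lemma length_le_chain B C A k n :
  chain q B C k -> length_le q B A (k + n) -> length_le q C A n.
Proof.
move=> ch le l chl; rewrite -(leq_add2l k); apply: le; exact: chain_cat chl.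
Qed.

End Level.
End Chains.

Arguments additive_pow : clear implicits.
Arguments additive_pow1 : clear implicits.

(** * Bracket powers and lengths *)

Section Lengths.
Context {R : comNzRingType}.
Implicit Types (q k n : nat) (a b c r u v x y z : R) (A B C I J K N : set R)
  (s : seq R).

(** Taking the intersection of all ideals that contain the [q]-th powers avoids a choice of
    generators and lets an inclusion be tested on [q]-th powers. *)
Definition bracket q J : set R :=
  [set x | forall A, submod 1 A -> (forall z, J z -> A (z ^+ q)) -> A x].

Lemma ideal_sub_submod q N : submod 1 N -> submod q N.
Proof. by case=> N0 NZD; split=> // a x y; apply: NZD. Qed.

Lemma submodMl N a x : submod 1 N -> N x -> N (a * x).
Proof. exact: submodZ. Qed.

Lemma submod_powr q q' N : submod q N -> submod (q' * q) N.
Proof. by case=> N0 NZD; split=> // a x y; rewrite exprM; apply: NZD. Qed.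

Lemma submod_powl q q' N : submod q N -> submod (q * q') N.
Proof. by rewrite mulnC; apply: submod_powr. Qed.

Lemma chain_powl q q' B A k : chain q B A k -> chain (q * q') B A k.
Proof.
elim=> [C Csub BC|C C' {}k _ IH C'sub CC'].
  by apply: chain0 => //; apply: submod_powl.
by apply: chainS IH _ CC'; apply: submod_powl.
Qed.

Lemma ideal_chain q B A k : chain 1 B A k -> chain q B A k.
Proof. by rewrite -[q]mul1n; apply: chain_powl. Qed.

Lemma submod_preim_pow q A :
  additive_pow R q -> submod 1 A -> submod 1 [set x | A (x ^+ q)].
Proof.
move=> qD Asub; split=> /= [|a x y Ax Ay]; first by rewrite pow0 //;
  exact: (submod0 Asub).
by rewrite qD exprMn; apply: (submodD Asub) => //; apply: submodMl.
Qed.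

Lemma submod_preimMr q A z : submod q A -> submod q [set x | A (x * z)].
Proof.
move=> Asub; split=> /= [|a x y Ax Ay]; first by rewrite mul0r;
  exact: (submod0 Asub).
by rewrite mulrDl -mulrA; apply: (submodD Asub) => //; apply: (submodZ _ Asub).
Qed.

Lemma submod_bracket q J : submod 1 (bracket q J).
Proof.
split=> [A Asub _|a x y Jx Jy A Asub JA]; first exact: (submod0 Asub).
by apply: (submodD Asub); [apply: submodMl => //; apply: Jx | apply: Jy].
Qed.

Lemma mem_bracket q J z : J z -> bracket q J (z ^+ q).
Proof. by move=> Jz A _; apply. Qed.

Lemma bracket_min q J A : submod 1 A -> (forall z, J z -> A (z ^+ q)) ->
  bracket q J `<=` A.
Proof. by move=> Asub JA x; apply. Qed.

Lemma bracketS q J J' : J `<=` J' -> bracket q J `<=` bracket q J'.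
Proof.
move=> JJ'; apply: bracket_min; first exact: submod_bracket.
by move=> z /JJ'; apply: mem_bracket.
Qed.

(** The preimage of an ideal under [x |-> x^q] is an ideal, so membership of [z^q] has to be checked
    only for [z] a [q']-th power of an element of [J]. *)
Lemma bracketM q q' J : additive_pow R q ->
  bracket q (bracket q' J) = bracket (q' * q) J.
Proof.
move=> qD; apply/seteqP; split; last first.
  apply: bracket_min => [|z Jz]; first exact: submod_bracket.
  by rewrite exprM; do 2!apply: mem_bracket.
apply: bracket_min => [|z]; first exact: submod_bracket.
move: z; apply: (@bracket_min _ _ [set x | bracket (q' * q) J (x ^+ q)]).
  exact/submod_preim_pow/submod_bracket.
by move=> z Jz /=; rewrite -exprM; apply: mem_bracket.
Qed.

Lemma bracket_adjoin q J u : additive_pow R q ->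
  bracket q (adjoin 1 J u) `<=` adjoin 1 (bracket q J) (u ^+ q).
Proof.
move=> qD; apply: bracket_min => [|z [r Jz]].
  exact/(submod_adjoin (additive_pow1 R))/submod_bracket.
exists (r ^+ q); rewrite expr1 -exprMn -(powB qD); exact: mem_bracket.
Qed.

Lemma bracket_adjoins q J s : additive_pow R q ->
  bracket q (adjoins 1 J s) `<=` adjoins 1 (bracket q J) [seq z ^+ q | z <- s].
Proof.
move=> qD; elim: s J => [|u s IHs] J /=; first exact: subset_refl.
by apply: subset_trans (IHs _) _; apply: adjoinsS; apply: bracket_adjoin.
Qed.

Lemma bracket0 q : (0 < q)%N -> bracket q [set 0] `<=` [set 0 : R].
Proof.
move=> q_gt0; apply: bracket_min => [|z ->]; first exact: submod_0.
by rewrite /= expr0n gtn_eqF.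
Qed.

(* [(N + R z) / N] is a quotient of [R / K], the scalars acting through
   [q]-th powers. *)
Lemma length_le_cyclic q q' N K z n : additive_pow R q ->
  additive_pow R q' ->  submod q' K -> (forall c, K c -> N (c ^+ q * z)) ->
  length_le q' K setT n -> length_le (q' * q) N (adjoin q N z) n.
Proof.
move=> qD qD' Ksub KN le k ch; apply: le.
suff: forall A, chain (q' * q) N A k -> A `<=` adjoin q N z ->
    chain q' K [set c | A (c ^+ q * z)] k.
  by move=> /(_ _ ch (@subset_refl _ _)) /chainSr; apply.
have Ppre A : submod (q' * q) A -> submod q' [set c | A (c ^+ q * z)].
  move=> Asub; split=> /= [|a x y Ax Ay].
    by rewrite pow0 // mul0r; exact: (submod0 Asub).
  rewrite qD mulrDl exprMn -exprM -mulrA.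
  by apply: (submodD Asub) => //; apply: (submodZ _ Asub).
move=> {ch} A; elim=> [C Csub NC _|C C' {}k chC IH C'sub [CC' nC'C] C'N].
  by apply: chain0 => [|c /KN /NC//]; apply: Ppre.
have Csub := chain_submod chC; have NC := chain_sub chC.
apply: chainS (IH (subset_trans CC' C'N)) (Ppre _ C'sub) _.
split=> [c /CC'//|pC]; apply: nC'C => w C'w.
have [r Nr] := C'N _ C'w.
apply: (submodBr Csub) (NC _ Nr); apply: pC => /=.
rewrite -(subKr w (_ * z)); apply: (submodB _ C'sub) => //.
  exact: additive_powM.
by apply/CC'/NC.
Qed.

(** Adjoining the generators one at a time gives [size s] cyclic factors, each a quotient of
    [R / K]. *)
Lemma length_le_adjoins q q' N K s n : additive_pow R q ->
  additive_pow R q' -> submod q N -> submod q' K ->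
  {in s, forall z c, K c -> N (c ^+ q * z)} ->
  length_le q' K setT n -> length_le (q' * q) N (adjoins q N s) (size s * n).
Proof.
move=> qD qD' Nsub Ksub KN le; elim: s N Nsub KN => [|z s IHs] N Nsub KN /=.
  by apply: length_le_refl => //; apply: submod_powr.
have Zsub := submod_adjoin qD z Nsub.
rewrite mulSn; apply: (@length_le_trans _ _ _ _ (adjoin q N z)) => //.
- exact: additive_powM.
- exact: submod_powr.
- exact: submod_powr.
- exact: sub_adjoin.
- exact: sub_adjoins.
- exact/submod_powr/submod_adjoins.
- by apply: (length_le_cyclic _ _ Ksub) => // c; apply: KN; rewrite mem_head.
apply: IHs => // v vs c Kc; apply: sub_adjoin => //; apply: KN Kc.
by rewrite in_cons vs orbT.
Qed.

Lemma adjoin_exp1 I a : submod 1 I -> adjoin 1 I (a ^+ 0) = setT.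
Proof.
move=> Isub; apply/seteqP; split=> // x _; exists x.
by rewrite expr1 mulr1 subrr; exact: (submod0 Isub).
Qed.

(** Filter by the ideals [I + (a^j)]: multiplication by [a^j] maps [R / (I + (a))] onto the [j]-th
    factor. *)
Lemma length_le_adjoin_pow I a n t : submod 1 I ->
  length_le 1 (adjoin 1 I a) setT t ->
  length_le 1 (adjoin 1 I (a ^+ n)) setT (n * t).
Proof.
have D1 := additive_pow1 R; move=> Isub le; elim: n => [|n IHn].
  by rewrite adjoin_exp1 //; apply: length_le_refl => //; exact: submodT.
have sub k := submod_adjoin D1 (a ^+ k) Isub.
have pow_sub : adjoin 1 I (a ^+ n.+1) `<=` adjoin 1 I (a ^+ n).
  apply: adjoin_min (sub n) _ _; first exact: sub_adjoin.
  by rewrite exprS; apply: submodMl (sub n) _; apply: mem_adjoin.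
rewrite mulSn; apply: (@length_le_trans _ _ D1 _ (adjoin 1 I (a ^+ n))) => //.
have : length_le (1 * 1) (adjoin 1 I (a ^+ n.+1))
    (adjoin 1 (adjoin 1 I (a ^+ n.+1)) (a ^+ n)) t.
  apply: (@length_le_cyclic _ _ _ (adjoin 1 I a)) => //.
    exact: submod_adjoin.
  move=> c [r Ir]; exists r; rewrite !expr1 exprS.
  rewrite (_ : _ - _ = a ^+ n * (c - r * a)); last by ring.
  exact: submodMl.
rewrite mul1n; apply: length_leSr; first exact: submod_adjoin.
by apply: adjoinS; apply: sub_adjoin.
Qed.

Lemma length_le_adjoins_pow I s n t : submod 1 I ->
  length_le 1 (adjoins 1 I s) setT t ->
  length_le 1 (adjoins 1 I [seq a ^+ n | a <- s]) setT (n ^ size s * t).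
Proof.
have D1 := additive_pow1 R.
elim: s I => [|a s IHs] I Isub /= le; first by rewrite mul1n.
rewrite adjoins_adjoin expnS -mulnA; apply: length_le_adjoin_pow.
  exact: submod_adjoins.
by rewrite -adjoins_adjoin; apply: IHs => //; apply: submod_adjoin.
Qed.

(** The chain is carried along [C |-> g C + B]. It stays strict because [g z - g w] in [B] forces
    [z - w] into [K], which lies in every member of the chain. *)
Lemma chain_mull B K A g k : submod 1 B -> (forall x, B (g * x) -> K x) ->
  chain 1 K A k -> chain 1 B [set x | exists2 z, A z & B (x - g * z)] k.
Proof.
have D1 := additive_pow1 R; move=> Bsub BK.
have Psub C : submod 1 C -> submod 1 [set x | exists2 z, C z & B (x - g * z)].
  move=> Csub; split=> /=.
    by exists 0; rewrite ?mulr0 ?subr0;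
      [exact: (submod0 Csub)|exact: (submod0 Bsub)].
  move=> a x y [u Cu Bu] [v Cv Bv]; exists (a * u + v).
    by apply: (submodD Csub) => //; apply: submodMl.
  rewrite expr1 (_ : _ - _ = a * (x - g * u) + (y - g * v)); last by ring.
  by apply: (submodD Bsub) => //; apply: submodMl.
elim=> [C Csub KC|C C' {}k chC IH C'sub [CC' nC'C]].
  apply: chain0 => [|x Bx]; first exact: Psub.
  by exists 0; rewrite ?mulr0 ?subr0 //; exact: (submod0 Csub).
apply: chainS IH (Psub _ C'sub) _; split=> [x [z /CC']|pC]; first by exists z.
have Csub := chain_submod chC.
apply: nC'C => z C'z; have [|w Cw] := pC (g * z).
  by exists z => //; rewrite subrr; exact: (submod0 Bsub).
by rewrite -mulrBr => /BK /(chain_sub chC); apply: (submodBr Csub).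
Qed.

(** The filtration is that of [length_le_adjoin_pow]. The colon hypothesis makes multiplication by
    [a^j] injective from [R / (I + (a))] into the [j]-th factor, so each factor has length at least
    [t]. *)
Lemma chain_pow I a n t : submod 1 I ->
  (forall j x, (j < n)%N -> adjoin 1 I (a ^+ j.+1) (a ^+ j * x) ->
    adjoin 1 I a x) ->
  chain 1 (adjoin 1 I a) setT t -> chain 1 (adjoin 1 I (a ^+ n)) setT (n * t).
Proof.
have D1 := additive_pow1 R; move=> Isub; elim: n => [|n IHn] colon ch.
  by rewrite adjoin_exp1 //; apply: chain0.
have sub k := submod_adjoin D1 (a ^+ k) Isub.
rewrite mulSn; apply: (@chain_cat _ _ _ (adjoin 1 I (a ^+ n))); last first.
  by apply: IHn ch => j x jn; apply: colon; apply: ltnW.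
apply: chainSr (chain_mull (sub _) (fun x => colon n x (ltnSn n)) ch) (sub _) _.
move=> x [z _ [r Ir]]; exists (z + r * a).
rewrite expr1 (_ : _ - _ = x - a ^+ n * z - r ^+ 1 * a ^+ n.+1) //.
by rewrite expr1 exprS; ring.
Qed.

(** * Regular sequences modulo an ideal and their powers *)

Definition nonzerodivisor_mod I a : Prop := forall x, I (a * x) -> I x.

Fixpoint regular_mod I s : Prop :=
  if s is a :: s' then nonzerodivisor_mod I a /\ regular_mod (adjoin 1 I a) s'
  else True.

(** If [a x = r b] modulo [I], then [r = t a] modulo [I], and cancelling [a] gives [x = t b]. *)
Lemma nonzerodivisor_mod_swap I a b : submod 1 I -> nonzerodivisor_mod I a ->
  nonzerodivisor_mod (adjoin 1 I a) b -> nonzerodivisor_mod (adjoin 1 I b) a.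
Proof.
move=> Isub nza nzb x [r Ir].
have [|t It] := nzb r.
  exists x; rewrite expr1 in Ir *; rewrite (_ : _ - _ = - (a * x - r * b)).
    exact: submodN (additive_pow1 R) _ _ Isub Ir.
  by ring.
exists t; apply: nza; rewrite expr1 in Ir It *.
rewrite (_ : _ * _ = (a * x - r * b) + b * (r - t * a)); last by ring.
by apply: (submodD Isub) => //; apply: submodMl.
Qed.

(** If [b x = r a^(n+1)] modulo [I], then [x = t a]; cancelling [a] leaves [b t = r a^n], to which
    induction applies. *)
Lemma nonzerodivisor_mod_pow I a b n : submod 1 I -> nonzerodivisor_mod I a ->
  nonzerodivisor_mod (adjoin 1 I a) b ->
  nonzerodivisor_mod (adjoin 1 I (a ^+ n)) b.
Proof.
move=> Isub nza nzb; elim: n => [|n IHn] x; first by rewrite adjoin_exp1.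
have D1 := additive_pow1 R.
have sub k := submod_adjoin D1 (a ^+ k) Isub.
case=> r Ir; have [|t It] := nzb x.
  by exists (r * a ^+ n); rewrite expr1 in Ir *; rewrite -mulrA -exprSr.
have [|u Iu] := IHn t.
  exists r; apply: nza; rewrite !expr1 in Ir It *.
  rewrite (_ : _ * _ = b * x - r * a ^+ n.+1 - b * (x - t * a)).
    by apply: (submodB D1 Isub) => //; apply: submodMl.
  by rewrite exprS; ring.
exists u; rewrite !expr1 in It Iu *.
rewrite (_ : _ - _ = x - t * a + a * (t - u * a ^+ n)); last by rewrite exprS;
  ring.
by apply: (submodD Isub) => //; apply: submodMl.
Qed.

Lemma regular_mod_pow_head I a s n : submod 1 I -> nonzerodivisor_mod I a ->
  regular_mod (adjoin 1 I a) s -> regular_mod (adjoin 1 I (a ^+ n)) s.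
Proof.
elim: s I => //= b s IHs I Isub nza [nzb reg]; split.
  exact: nonzerodivisor_mod_pow.
rewrite adjoinC; apply: IHs.
- exact: (submod_adjoin (additive_pow1 R)).
- exact: nonzerodivisor_mod_swap.
- by rewrite adjoinC.
Qed.

Lemma regular_mod_pow I s n : submod 1 I -> regular_mod I s ->
  regular_mod I [seq a ^+ n | a <- s].
Proof.
elim: s I => //= a s IHs I Isub [nza reg]; split.
  by elim: n {IHs} => [|n IHn] x; rewrite ?mul1r // exprS -mulrA => /nza/IHn.
apply: regular_mod_pow_head => //; apply: IHs => //.
exact: (submod_adjoin (additive_pow1 R)).
Qed.

(** Repeated swaps move [a] from the head of the sequence to its end. *)
Lemma nonzerodivisor_mod_adjoins I a s : submod 1 I ->
  nonzerodivisor_mod I a -> regular_mod (adjoin 1 I a) s ->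
  nonzerodivisor_mod (adjoins 1 I s) a.
Proof.
elim: s I => //= b s IHs I Isub nza [nzb reg]; apply: IHs.
- exact: (submod_adjoin (additive_pow1 R)).
- exact: nonzerodivisor_mod_swap.
- by rewrite adjoinC.
Qed.

(** For a regular sequence the bound of [length_le_adjoins_pow] is attained. The tail is raised to
    powers first; the head [a] stays a nonzerodivisor modulo these powers, which is the colon
    condition of [chain_pow]. *)
Lemma chain_regular_mod I s n t : submod 1 I -> regular_mod I s ->
  chain 1 (adjoins 1 I s) setT t ->
  chain 1 (adjoins 1 I [seq a ^+ n | a <- s]) setT (n ^ size s * t).
Proof.
have D1 := additive_pow1 R.
elim: s I => [|a s IHs] I Isub /= reg ch; first by rewrite mul1n.
have [nza regs] := reg; have asub := submod_adjoin D1 a Isub.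
rewrite adjoins_adjoin expnS -mulnA; apply: chain_pow.
- exact: submod_adjoins.
- have nza' := nonzerodivisor_mod_adjoins Isub nza (regular_mod_pow n asub regs).
  move=> j x _ [r Ir]; exists r; move: Ir; rewrite !expr1 exprSr.
  rewrite (_ : _ - _ = a ^+ j * (x - r * a)); last by ring.
  by elim: j => [|j IHj]; rewrite ?mul1r // exprS -mulrA => /nza'/IHj.
- by rewrite -adjoins_adjoin; apply: IHs.
Qed.

End Lengths.

(** * Local rings *)

Section Local.
Context {R : comNzRingType}.
Implicit Types (q k n : nat) (a b c r u v w x y z : R) (A B C I J K N W : set R)
  (s : seq R).

Definition local_ideal (m : set R) : Prop :=
  [/\ submod 1 m, ~ m 1 & forall x, ~ m x -> exists y, y * x = 1].

Definition residue_perfect (m : set R) q : Prop :=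
  forall x, exists y, m (x - y ^+ q).

Lemma residue_perfect1 m : submod 1 m -> residue_perfect m 1.
Proof. by move=> msub x; exists x; rewrite subrr; exact: (submod0 msub). Qed.

Section LocalIdeal.
Context (m : set R) (mloc : local_ideal m).

Lemma submod_local : submod 1 m. Proof. by case: mloc. Qed.

(** The inverse of [1 - r^q] is itself a [q]-th power, hence a scalar of [R^{1/q}]; Nakayama's lemma
    depends on this. *)
Lemma local_sub1_unit r q : additive_pow R q -> m r ->
  exists y, y ^+ q * (1 - r ^+ q) = 1.
Proof.
move=> qD mr; have [msub m1 mV] := mloc.
have [|y yE] := mV (1 - r); first by move/(submodBr msub mr).
by exists y; rewrite -{1}(expr1n _ q) -powB // -exprMn yE expr1n.
Qed.

(** A second step of a chain would contain some [u] outside [m]. With [v u = 1] and [x v = y^q]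
    modulo [m], every [x] equals [y^q u] modulo [m], so that member is already all of [R]. *)
Lemma length_le_residue q : additive_pow R q -> residue_perfect m q ->
  length_le q m setT 1.
Proof.
move=> qD perf k ch; rewrite leqNgt; apply/negP => k_gt1.
have [C' [/chain_last[C [chC C'sub [CC' nC'C]]] _ [_ nTC']]] :=
  chain_last (chain_leq k_gt1 ch).
have [msub _ mV] := mloc; have mC' := subset_trans (chain_sub chC) CC'.
apply: nC'C => u C'u; apply: contrapT => nCu; apply: nTC' => x _.
have [|v vu] := mV u; first by move/(chain_sub chC).
have [y mxy] := perf (x * v).
rewrite (_ : x = y ^+ q * u + (x * v - y ^+ q) * u); last first.
  by rewrite mulrBl -mulrA vu; ring.
apply: (submodD C'sub); first exact: submodZ.
by apply: mC'; rewrite mulrC; apply: submodMl.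
Qed.

(** Otherwise any [u] outside [J] has a multiple [r u] outside [J] with [r] in [m]. Iterating gives
    arbitrarily long chains, strict because [u = t r u] modulo [J] would put [u] in [J]. *)
Lemma socle_ex J w n : submod 1 J -> ~ J w -> length_le 1 J setT n ->
  exists2 u, ~ J u & forall r, m r -> J (r * u).
Proof.
have D1 := additive_pow1 R; move=> Jsub nJw le; apply: contrapT => nsoc.
have step u : ~ J u -> exists2 r, m r & ~ J (r * u).
  move=> nJu; apply: contrapT => nr; apply: nsoc; exists u => // r mr.
  by apply: contrapT => nJru; apply: nr; exists r.
suff ch k u : ~ J u -> chain 1 J (adjoin 1 J u) k.
  by have := le _ (chainSr (ch n.+1 w nJw) (submodT _) (@subsetT _ _));
    rewrite ltnn.
elim: k u => [|k IHk] u nJu.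
  by apply: chain0; [exact: submod_adjoin | exact: sub_adjoin].
have [r mr nJru] := step u nJu.
apply: chainS (IHk _ nJru) (submod_adjoin D1 _ Jsub) _; split.
  apply: adjoin_min (submod_adjoin D1 _ Jsub) _ _; first exact: sub_adjoin.
  by apply: submodMl (submod_adjoin D1 _ Jsub) _; apply: mem_adjoin.
move=> /(_ u (mem_adjoin _ Jsub))[t Jt]; apply: nJu.
have [msub _ _] := mloc.
have [y yE] := local_sub1_unit D1 (submodMl t msub mr).
rewrite -[u]mul1r -yE -mulrA; apply: submodMl => //.
by rewrite (_ : _ * u = u - t ^+ 1 * (r * u)) // !expr1; ring.
Qed.

(** Induction on colength: each step adjoins a socle element of [R / J], so [R / J] is filtered with
    factors killed by [m]. *)
Lemma colength_ind (P : set R -> nat -> Prop) :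
  (forall J n, submod 1 J -> setT `<=` J -> P J n) ->
  (forall J n u, submod 1 J -> (forall r, m r -> J (r * u)) ->
     P (adjoin 1 J u) n -> P J n.+1) ->
  forall J n, submod 1 J -> length_le 1 J setT n -> P J n.
Proof.
have D1 := additive_pow1 R; move=> PT PS J n; elim: n J => [|n IHn] J Jsub le.
  apply: PT => // w _; apply: contrapT => nJw.
  have ch := chainSr (chain_adjoin D1 Jsub nJw) (submodT _) (@subsetT _ _).
  by have := le _ ch.
have [JT|] := EM (setT `<=` J); first exact: PT.
move=> nJT; have [w nJw] : exists w, ~ J w.
  by apply: contrapT => nw; apply: nJT => w _; apply: contrapT => nJw;
    apply: nw; exists w.
have [u nJu mu] := socle_ex Jsub nJw le; apply: PS mu _ => //.
apply: IHn; first exact: submod_adjoin.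
exact: length_le_chain (chain_adjoin D1 Jsub nJu) le.
Qed.

(** Restricting scalars to [q]-th powers keeps each factor [R / m] of length at most one, the
    residue field being perfect. *)
Lemma length_le_restrict q J n : additive_pow R q -> residue_perfect m q ->
  submod 1 J -> length_le 1 J setT n -> length_le q J setT n.
Proof.
move=> qD perf; apply: (colength_ind (P := length_le q ^~ setT)).
  move=> {}J {}n Jsub JT; apply: (@length_leW _ _ _ _ 0) => //.
  by apply: length_le_refl => //; apply: ideal_sub_submod.
move=> {}J {}n u Jsub Ju le; have D1 := additive_pow1 R.
have Usub := submod_adjoin D1 u Jsub.
rewrite -add1n; apply: length_le_trans le => //.
- exact: ideal_sub_submod.
- exact: ideal_sub_submod.
- exact: sub_adjoin.
rewrite -[q]muln1; apply: length_le_cyclic (length_le_residue qD perf) => //.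
exact: ideal_sub_submod submod_local.
Qed.

(** Adjoining a socle element [u] to [J] adjoins [u^q] to [J^[q]]. Since [m^[q]] kills [u^q] modulo
    [J^[q]], the new factor is a quotient of [R / m^[q]]. *)
Lemma length_le_bracket q J n t : additive_pow R q -> submod 1 J ->
  length_le 1 J setT n -> length_le q (bracket q m) setT t ->
  length_le q (bracket q J) setT (n * t).
Proof.
move=> qD Jsub leJ le; have D1 := additive_pow1 R.
move: J n Jsub leJ.
apply: (colength_ind (P := fun J n => length_le q (bracket q J) setT (n * t))).
  move=> J n Jsub JT; apply: (@length_leW _ _ _ _ 0) => //.
  apply: length_le_refl => [|x _]; first exact/ideal_sub_submod/submod_bracket.
  rewrite -[x]mulr1 -[1](expr1n _ q); apply: submodMl (submod_bracket _ _) _.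
  by apply: mem_bracket; apply: JT.
move=> J n u Jsub Ju leU; have Bsub := submod_bracket q J.
have Asub := submod_adjoin D1 (u ^+ q) Bsub.
rewrite mulSn; apply: (@length_le_trans _ _ qD _ (adjoin 1 (bracket q J) (u ^+ q))) => //.
- exact: ideal_sub_submod.
- exact: ideal_sub_submod.
- exact: sub_adjoin.
- rewrite -[X in length_le X]muln1; apply: length_le_cyclic le => //.
    by apply: ideal_sub_submod; apply: submod_bracket.
  apply: (bracket_min (submod_preimMr _ Bsub)) => r mr /=.
  by rewrite -exprMn; apply: mem_bracket; apply: Ju.
by apply: length_leSl leU; apply: bracket_adjoin.
Qed.

(** The last hypothesis encodes [A <= W + m A] by quantifying over the submodules that contain [W]
    and [m A]. Generators are removed one at a time: modulo [W], the remaining one satisfies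
    [u = r^q u] with [r] in [m], and [1 - r^q] is a unit. *)
Lemma nakayama q W A s : additive_pow R q -> submod q W ->
  {in s, forall u, A u} -> A `<=` adjoins q W s ->
  (forall N, submod q N -> W `<=` N ->
     (forall z a, m z -> A a -> N (z ^+ q * a)) -> A `<=` N) ->
  A `<=` W.
Proof.
move=> qD; elim: s W => //= u s IHs W Wsub sA AW AmA.
have Au : A u by apply: sA; rewrite mem_head.
have {IHs} AWu : A `<=` adjoin q W u.
  apply: IHs (submod_adjoin qD _ Wsub) _ AW _ => [v vs|N Nsub WN].
    by apply: sA; rewrite in_cons vs orbT.
  by apply: AmA => // x /(@sub_adjoin _ _ qD _ u); apply: WN.
have msub := submod_local.
suff Wu : W u by move=> x /AWu; apply: adjoin_min.
have [|||r mr Wr] := AmA [set x | exists2 r, m r & W (x - r ^+ q * u)] _ _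
  _ u Au.
- split=> /=.
    by exists 0; [exact: (submod0 msub) | rewrite pow0 // mul0r subr0;
      exact: (submod0 Wsub)].
  move=> a x y [r mr Wr] [t mt Wt]; exists (a * r + t).
    by apply: (submodD msub) => //; apply: submodMl.
  rewrite qD exprMn (_ : _ - _ = a ^+ q * (x - r ^+ q * u) + (y - t ^+ q * u)); last by ring.
  by apply: (submodD Wsub) => //; apply: submodZ.
- by move=> x Wx; exists 0;
    [exact: (submod0 msub) | rewrite pow0 // mul0r subr0].
- move=> z a mz /AWu[c Wc]; exists (z * c); first by rewrite mulrC;
    apply: submodMl.
  by rewrite exprMn -mulrA -mulrBr; apply: submodZ.
have [y yE] := local_sub1_unit qD mr.
rewrite -[u]mul1r -yE -mulrA; apply: submodZ => //.
by rewrite mulrBl mul1r.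
Qed.

(** Every generator chosen outside the submodule reached so far uses up one unit of length. *)
Lemma generators_of_length q B A n : additive_pow R q -> submod q A ->
  submod q B -> B `<=` A -> length_le q B A n ->
  exists s, [/\ (size s <= n)%N, {in s, forall u, A u} & A `<=` adjoins q B s].
Proof.
move=> qD Asub; elim: n B => [|n IHn] B Bsub BA le.
  exists [::]; split=> //= u Au; apply: contrapT => nBu.
  have : chain q B A 1.
    by apply: (chainSr (chain_adjoin qD Bsub nBu) Asub); apply: adjoin_min.
  by move/le.
have [AB|nAB] := EM (A `<=` B); first by exists [::].
have [u Au nBu] : exists2 u, A u & ~ B u.
  by apply: contrapT => nu; apply: nAB => u Au; apply: contrapT => nBu;
    apply: nu; exists u.
have [||s [size_s sA As]] := IHn (adjoin q B u) (submod_adjoin qD _ Bsub).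
- exact: adjoin_min.
- exact: length_le_chain (chain_adjoin qD Bsub nBu) le.
by exists (u :: s); split=> // v; rewrite in_cons => /predU1P[->|/sA].
Qed.

End LocalIdeal.
End Local.

(** * Noetherian local rings *)

Section Noetherian.
Context {R : comNzRingType}.
Implicit Types (k n : nat) (a b c r u v w x y z : R) (A B C D E I J N Q : set R)
  (s : seq R).
Let D1 := additive_pow1 R.

Lemma ideal_genE s : ideal_gen s = adjoins 1 [set 0] s.
Proof.
apply/seteqP; split=> x.
  move=> [c ->]; apply/adjoinsP; exists c.
  by apply/eqP; rewrite subr_eq0.
by move/adjoinsP => [c /eqP]; rewrite subr_eq0 => /eqP ->; exists c.
Qed.

Lemma adjoins_rcons q N s a :
  adjoins q N (rcons s a) = adjoin q (adjoins q N s) a.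
Proof. by elim: s N => //= b s IHs N; rewrite IHs. Qed.

Lemma uniform_exponent (P : R -> nat -> Prop) s :
  (forall x k n, (k <= n)%N -> P x k -> P x n) ->
  {in s, forall x, exists n, P x n} -> exists n, {in s, forall x, P x n}.
Proof.
move=> Pmono; elim: s => [|x s IHs] Ps; first by exists 0%N.
have [|n Pn] := IHs; first by move=> y ys; apply: Ps; rewrite in_cons ys orbT.
have [|k Pk] := Ps x; first by rewrite mem_head.
exists (maxn k n) => y; rewrite in_cons => /predU1P[->|/Pn].
  by apply: Pmono Pk; rewrite leq_maxl.
by apply: Pmono; rewrite leq_maxr.
Qed.

(** One application of Zorn's lemma serves three purposes: maximal ideals, primes avoiding a
    multiplicative set, and Krull's intersection theorem. *)
Lemma maximal_ideal_ex I D E : submod 1 I -> I `&` D `<=` E ->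
  exists C, [/\ submod 1 C, I `<=` C, C `&` D `<=` E &
    forall C', submod 1 C' -> C `<=` C' -> C' `&` D `<=` E -> C' `<=` C].
Proof.
move=> Isub IDE.
pose good X := [/\ submod 1 X, I `<=` X & X `&` D `<=` E].
have [F Fgood Ftot|C [gC maxC]] := @Zorn_bigcup R [set X | X = set0 \/ good X].
  have [[X0 [FX0 gX0]]|nF] := EM (exists X, F X /\ good X); last first.
    left; rewrite -subset0 => x [X FX Xx].
    have [X0|gX] := Fgood _ FX; first by rewrite X0 in Xx.
    by apply: nF; exists X.
  right; have [[X00 _] IX0 _] := gX0; split; last first.
  - move=> x [[X FX Xx] Dx].
    have [XE|[_ _]] := Fgood _ FX; first by rewrite XE in Xx.
    by apply; split.
  - by move=> x /IX0 X0x; exists X0.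
  split=> [|a x y [X FX Xx] [Y FY Yy]]; first by exists X0.
  have [XE|[Xsub _ _]] := Fgood _ FX; first by rewrite XE in Xx.
  have [YE|[Ysub _ _]] := Fgood _ FY; first by rewrite YE in Yy.
  have [XY|YX] := Ftot _ _ FX FY.
    by exists Y => //; case: Ysub => _; apply=> //; apply: XY.
  by exists X => //; case: Xsub => _; apply=> //; apply: YX.
have {gC} [Csub IC CDE] : good C.
  case: gC => // C0; exfalso; apply: (maxC I); last by right; split.
  by rewrite C0; split=> // I0; exact: (I0 0 (submod0 Isub)).
exists C; split=> // C' C'sub CC' C'DE; apply: contrapT => nC'C.
apply: (maxC C'); first by split.
by right; split=> //; apply: subset_trans IC CC'.
Qed.

Lemma local_ring_local_ideal (m : set R) : local_ring m -> local_ideal m.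
Proof.
case=> [[msub m1 _] muniq]; split=> // x nmx.
have [[r] /=|no1] := EM (adjoin 1 [set 0] x 1).
  by move/eqP; rewrite subr_eq0 => /eqP rx; exists r.
have [|C [Csub xC C1 Cmax]] :=
  @maximal_ideal_ex (adjoin 1 [set 0] x) [set 1] set0
    (submod_adjoin D1 x (submod_0 1)).
  by move=> y [xy] /= y1; apply: no1; rewrite -y1.
case: nmx; rewrite -(muniq C).
  by apply: xC; apply: (mem_adjoin _ (submod_0 1)).
split=> // [C1'|J Jsub CJ]; first exact: (C1 1).
have [J1|nJ1] := EM (J 1).
  right; apply/seteqP; split=> // y _; rewrite -[y]mulr1; exact: submodMl.
left; apply/seteqP; split=> //; apply: Cmax => // y [Jy] /= y1.
by apply: nJ1; rewrite -y1.
Qed.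

Lemma ideal_sub_local (m : set R) J : local_ideal m -> submod 1 J -> ~ J 1 ->
  J `<=` m.
Proof.
case=> _ _ mV Jsub nJ1 x Jx; apply: contrapT => /mV[y yx].
by apply: nJ1; rewrite -yx; apply: submodMl.
Qed.

Lemma prime_ideal_avoid I (T : set R) : submod 1 I -> T 1 ->
  (forall x y, T x -> T y -> T (x * y)) -> (forall x, I x -> ~ T x) ->
  exists Q, [/\ prime_ideal Q, I `<=` Q & forall x, Q x -> ~ T x].
Proof.
move=> Isub T1 TM IT.
have [x []|C [Csub IC CT Cmax]] := @maximal_ideal_ex I T set0 Isub.
  exact: IT.
exists C; split=> //; last by move=> x Cx Tx; exact: (CT x).
split=> // [C1|x y Cxy]; first exact: (CT 1).
have meet u : ~ C u -> exists c r, C c /\ T (c + r * u).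
  move=> nCu; apply: contrapT => no; apply: nCu.
  apply: (Cmax (adjoin 1 C u)); last exact: mem_adjoin.
  - exact: submod_adjoin.
  - exact: sub_adjoin.
  move=> z [[r Cz] Tz]; case: no; exists (z - r * u), r.
  by rewrite subrK.
apply: contrapT => /not_orP[/meet[c [r [Cc Tc]]] /meet[d [t [Cd Td]]]].
apply: (CT ((c + r * x) * (d + t * y))); split; last exact: TM.
rewrite (_ : _ * _ = (d + t * y) * c + (r * x * d + r * t * (x * y)));
  last by ring.
by apply: (submodD Csub); [|apply: (submodD Csub)]; apply: submodMl.
Qed.

(** Indexing by [nat] instead of ordinals lets a chain of primes be extended without casts. *)
Definition prime_tower (P : nat -> set R) k : Prop :=
  (forall i, (i <= k)%N -> prime_ideal (P i)) /\
  (forall i j, (i < j)%N -> (j <= k)%N -> P i `<` P j).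

Lemma prime_tower_chain P k :
  prime_tower P k -> prime_chain (fun i : 'I_k.+1 => P i).
Proof.
case=> Pprime Plt; split=> [i|i j ij]; first by apply: Pprime; rewrite -ltnS.
by apply: Plt => //; rewrite -ltnS.
Qed.

Lemma prime_tower_extend P k Q : prime_tower P k -> prime_ideal Q ->
  P k `<` Q -> prime_tower (fun i => if (i <= k)%N then P i else Q) k.+1.
Proof.
case=> Pprime Plt Qprime [PQ nQP]; split=> [i _|i j ij jk].
  by case: ifP => // /Pprime.
have [jk'|kj /=] := leqP j k; first by rewrite (leq_trans (ltnW ij)) //;
  apply: Plt.
have ik : (i <= k)%N by rewrite -ltnS (leq_trans ij).
rewrite ik; have [->|ink] := eqVneq i k; first by split.
have [PiPk _] : P i `<` P k by apply: Plt => //; rewrite ltn_neqAle ink.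
split; first exact: subset_trans PQ.
by move=> QPi; apply: nQP; apply: subset_trans PiPk.
Qed.

(** A prime containing the first [k] terms has height at least [k]. The last of these terms is a
    nonzerodivisor modulo the earlier ones, so some smaller prime contains the earlier ones and
    misses it. *)
Lemma regular_sequence_tower s k Q : regular_sequence s -> (k <= size s)%N ->
  prime_ideal Q -> adjoins 1 [set 0] (take k s) `<=` Q ->
  exists2 P, prime_tower P k & P k = Q.
Proof.
case=> reg _; elim: k Q => [|k IHk] Q ks Qprime sQ.
  exists (fun=> Q) => //; split=> // i j ij; rewrite leqn0 => /eqP j0.
  by rewrite j0 in ij.
have [Qsub Q1 Qmul] := Qprime.
set I := adjoins 1 [set 0] (take k s).
have Isub : submod 1 I by apply: submod_adjoins => //; exact: submod_0.
rewrite (take_nth 0) // adjoins_rcons -/I in sQ.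
(* A prime disjoint from [T] lies inside [Q] (take [n = 0]) and misses the new term (take
   [t = 1]). *)
pose T := [set x | exists t n, ~ Q t /\ x = t * s`_k ^+ n].
have IQ : I `<=` Q by apply: subset_trans sQ; exact: sub_adjoin.
have [|||Q' [Q'prime IQ' Q'T]] := @prime_ideal_avoid I T Isub.
- by exists 1, 0%N; rewrite mulr1.
- move=> _ _ [t [n [Qt ->]]] [t' [n' [Qt' ->]]]; exists (t * t'), (n + n')%N.
  by split; [case/Qmul | rewrite exprD; ring].
- move=> x Ix [t [n [Qt xE]]]; apply/Qt/IQ; rewrite xE in Ix.
  elim: n Ix {xE} => [|n IHn]; first by rewrite mulr1.
  move=> Ix; apply: IHn; rewrite /I -ideal_genE; apply: reg => //.
  by rewrite ideal_genE -/I mulrCA -exprS.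
have Q'sub : Q' `<=` Q.
  move=> x Q'x; apply: contrapT => Qx; apply: (Q'T x) => //.
  by exists x, 0%N; rewrite mulr1.
have [P Ptower Pk] := IHk Q' (ltnW ks) Q'prime IQ'.
exists (fun i => if (i <= k)%N then P i else Q); last by rewrite ltnn.
apply: prime_tower_extend => //; rewrite Pk; split=> // QQ'.
apply: (Q'T s`_k); last by exists 1, 1%N; rewrite mul1r.
by apply/QQ'/sQ; apply: mem_adjoin.
Qed.

Section NoetherianLocal.
Context (m : set R) (noethR : noetherian R) (mloc : local_ideal m).

Lemma noetherian_gen I : submod 1 I -> exists s, I = adjoins 1 [set 0] s.
Proof. by move=> /noethR[s ->]; exists s; rewrite ideal_genE. Qed.

(** If no power of [y] were in the ideal, a prime containing [s] but not [y] would have height at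
    least [size s] and lie strictly below [m], exceeding the dimension. *)
Lemma regular_sequence_radical s : krull_dim R (size s) ->
  regular_sequence s -> {in s, forall x, m x} ->
  forall y, m y -> exists n, adjoins 1 [set 0] s (y ^+ n).
Proof.
move=> [_ dimR] reg sm y my; have [msub m1 mV] := mloc.
set I := adjoins 1 [set 0] s; apply: contrapT => nIy.
have Isub : submod 1 I by apply: submod_adjoins => //; exact: submod_0.
have mprime : prime_ideal m.
  split=> // a b mab; apply: contrapT => /not_orP[/mV[a' a'E] /mV[b' b'E]].
  apply: m1; rewrite (_ : 1 = a' * b' * (a * b)); first exact: submodMl.
  by rewrite mulrACA a'E b'E mulr1.
have [|||Q [Qprime IQ Qy]] :=
  @prime_ideal_avoid I [set y ^+ n | n in setT] Isub.
- by exists 0%N.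
- by move=> _ _ [n _ <-] [n' _ <-]; exists (n + n')%N; rewrite // exprD.
- by move=> x Ix [n _ xE]; apply: nIy; exists n; rewrite xE.
have [P Ptower Ps] : exists2 P, prime_tower P (size s) & P (size s) = Q.
  by apply: regular_sequence_tower reg _ Qprime _; rewrite ?take_size.
have [Qsub Q1 _] := Qprime.
have Qm : P (size s) `<` m.
  rewrite Ps; split; first exact: ideal_sub_local.
  by move=> /(_ y my) Qy1; apply: (Qy y) => //; exists 1%N.
have /prime_tower_chain/dimR := prime_tower_extend Ptower mprime Qm.
by rewrite ltnn.
Qed.

Lemma finite_colength s : krull_dim R (size s) ->
  regular_sequence s -> {in s, forall x, m x} ->
  exists n, length_le 1 (adjoins 1 [set 0] s) setT n.
Proof.
move=> dimR reg sm; have rad := regular_sequence_radical dimR reg sm.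
set I := adjoins 1 [set 0] s in rad *; have [msub _ _] := mloc.
have Isub : submod 1 I by apply: submod_adjoins => //; exact: submod_0.
have [t mt] := noetherian_gen msub.
have [||n In] := @uniform_exponent (fun y n => I (y ^+ n)) t.
- by move=> x k n kn Ix; rewrite -(subnK kn) exprD; apply: submodMl.
- by move=> y yt; apply: rad; rewrite mt; apply: mem_adjoins (submod_0 1) yt.
exists (n ^ size t * 1)%N.
apply: (@length_leSl _ _ (adjoins 1 [set 0] [seq y ^+ n | y <- t])).
  apply: adjoins_min => // [_ ->|_ /mapP[y yt ->]]; first exact: (submod0 Isub).
  exact: In.
apply: length_le_adjoins_pow (submod_0 1) _; rewrite -mt.
exact: length_le_residue mloc _ D1 (residue_perfect1 msub).
Qed.

(* An ideal [C] maximal among those with [C :&: B <= m B] contains a power of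
   each element of [m], by stabilisation of the ideals [C : z ^ n]. *)
Lemma krull_intersection B : submod 1 B ->
  (forall C, submod 1 C -> (forall z, m z -> exists n, C (z ^+ n)) ->
     B `<=` C) -> B `<=` [set 0].
Proof.
move=> Bsub BC.
(* [M] is the product ideal [m B]. *)
pose M := [set x | forall N, submod 1 N ->
  (forall z b, m z -> B b -> N (z * b)) -> N x].
have Msub : submod 1 M.
  split=> [N Nsub _|a x y Mx My N Nsub mBN]; first exact: (submod0 Nsub).
  apply: (submodD Nsub); last exact: My.
  by apply: (submodMl _ Nsub); apply: Mx.
have [|C [Csub MC CBM Cmax]] := @maximal_ideal_ex M B M Msub.
  by move=> x [].
have powC z : m z -> exists n, C (z ^+ n).
  move=> mz; pose U := [set x | exists n, C (z ^+ n * x)].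
  have Cmono n k x : (n <= k)%N -> C (z ^+ n * x) -> C (z ^+ k * x).
    by move=> nk Cx; rewrite -(subnK nk) exprD -mulrA; apply: submodMl.
  have Usub : submod 1 U.
    split=> [|a x y [n Cx] [k Cy]]; first by exists 0%N; rewrite mulr0;
      exact: (submod0 Csub).
    exists (maxn n k); rewrite mulrDr mulrCA; apply: (submodD Csub).
      by apply: submodMl => //; apply: Cmono Cx; rewrite leq_maxl.
    by apply: Cmono Cy; rewrite leq_maxr.
  have [t Ut] := noetherian_gen Usub.
  have [||n Cn] := @uniform_exponent (fun x n => C (z ^+ n * x)) t.
  - by move=> x k n; apply: Cmono.
  - move=> x xt; have : U x by rewrite Ut; apply: mem_adjoins (submod_0 1) xt.
    by [].
  have stab x : C (z ^+ n.+1 * x) -> C (z ^+ n * x).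
    move=> Cx; suff : U `<=` [set x | C (z ^+ n * x)] by apply; exists n.+1.
    rewrite Ut; apply: adjoins_min => //; last first.
      by move=> _ -> /=; rewrite mulr0; exact: (submod0 Csub).
    split=> /= [|a u v Cu Cv]; first by rewrite mulr0; exact: (submod0 Csub).
    by rewrite mulrDr mulrCA; apply: (submodD Csub) => //; apply: submodMl.
  (* If [b = c + r z^n] is in [B] with [c] in [C], then [z b] is in [m B <= C], so [r z^(n+1)] is in
     [C]. Stability gives [r z^n] in [C], hence [b] in [C]; maximality then puts [z^n] in [C]. *)
  exists n; apply: (Cmax (adjoin 1 C (z ^+ n))); last exact: mem_adjoin.
  - exact: submod_adjoin.
  - exact: sub_adjoin.
  move=> b [[r Cb] Bb]; apply: CBM; split=> //.
  apply: (submodBr Csub _ Cb); rewrite mulrC; apply: stab.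
  rewrite expr1 in Cb *; rewrite (_ : _ * r = z * b - z * (b - r * z ^+ n));
    last by rewrite exprS; ring.
  apply: (submodB D1 Csub); last exact: submodMl.
  by apply: MC => N Nsub; apply.
have BM : B `<=` M.
  by move=> b Bb; apply: CBM; split=> //; apply: (BC C).
have [t Bt] := noetherian_gen Bsub.
apply: (nakayama mloc (s := t) D1 (submod_0 1)) => [u ut||N Nsub _ mBN].
- by rewrite Bt; apply: mem_adjoins (submod_0 1) ut.
- by rewrite -Bt.
by move=> b /BM; apply.
Qed.

End NoetherianLocal.
End Noetherian.

(** * Free direct summands *)

Section DirectSums.
Context {R : comNzRingType}.

Lemma internal_direct_sum_proj (M : lmodType R) n (N : 'I_n -> set M) :
  internal_direct_sum N -> exists pr : 'I_n -> M -> M,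
  [/\ forall i x, N i (pr i x), forall x, x = \sum_i pr i x,
      forall i a x y, pr i (a *: x + y) = a *: pr i x + pr i y &
      forall i j x, N i x -> pr j x = if i == j then x else 0].
Proof.
case=> Nsub dec.
pose comp x := projT1 (cid (dec x)).
have compP x : (forall i, N i (comp x i)) /\ x = \sum_i comp x i.
  by rewrite /comp; case: (cid _) => y [].
have compU x (y : {ffun 'I_n -> M}) :
    (forall i, N i (y i)) -> x = \sum_i y i -> comp x = y.
  by rewrite /comp => Ny xE; case: (cid _) => z /= [_ ]; apply.
exists (fun i x => comp x i); split=> [i x|x|i a x y|i j x Nx].
- by have [] := compP x.
- by have [] := compP x.
- have [Nx xE] := compP x; have [Ny yE] := compP y.
  rewrite (@compU _ [ffun i => a *: comp x i + comp y i]) ?ffunE // => [k|].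
    by rewrite ffunE; have [_] := Nsub k; apply.
  under eq_bigr do rewrite ffunE.
  by rewrite big_split /= -scaler_sumr -xE -yE.
rewrite (@compU _ [ffun k => if i == k then x else 0]) ?ffunE // => [k|].
  by rewrite ffunE; case: eqP => [<-//|_]; have [] := Nsub k.
under eq_bigr do rewrite ffunE.
by rewrite -big_mkcond /= (big_pred1 i) // => k; rewrite /= eq_sym.
Qed.

Lemma ring_copies_coordinates (M : lmodType R) a : ring_copies M a ->
  exists (phi : 'I_a -> M -> R) (v : 'I_a -> M),
  (forall i c x y, phi i (c *: x + y) = c * phi i x + phi i y) /\
  (forall i j, phi i (v j) = (i == j)%:R).
Proof.
case=> n [N [/internal_direct_sum_proj[pr [prN _ prL prE]] _ ->]].
set A := [set i | _]%SET.
have copy (k : 'I_#|A|) : is_copy_of_ring (N (enum_val k)).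
  by have := enum_valP k; rewrite inE => /asboolP.
pose f k := projT1 (cid (copy k)).
have f_inj k : injective (f k) by rewrite /f; case: (cid _) => g [].
have f_range k : range (f k) = N (enum_val k) by rewrite /f; case: (cid _) =>
  g [].
have preim k x : exists r, f k r = pr (enum_val k) x.
  by have := prN (enum_val k) x; rewrite -f_range => -[r _ <-]; exists r.
pose phi k x : R := projT1 (cid (preim k x)).
have phiE k x : f k (phi k x) = pr (enum_val k) x by rewrite /phi;
  case: (cid _).
have Nf k r : N (enum_val k) (f k r) by rewrite -f_range; exists r.
exists phi, (fun k => f k 1); split=> [k c x y|k l]; apply: (f_inj k).
  by rewrite phiE prL -!phiE [RHS](linearP (f k)).
rewrite phiE (prE _ _ _ (Nf l 1)) (inj_eq enum_val_inj) eq_sym.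
by case: eqP => [->//|_]; rewrite linear0.
Qed.

Definition scale_at (M : lmodType R) (u : M) (c : R^o) : M := c *: u.

Fact scale_at_linear (M : lmodType R) (u : M) : linear (scale_at u).
Proof. by move=> a x y; rewrite /scale_at scalerDl scalerA. Qed.

HB.instance Definition _ (M : lmodType R) (u : M) :=
  GRing.isLinear.Build R R^o M _ (scale_at u) (scale_at_linear u).

Lemma cyclic_is_copy_of_ring (M : lmodType R) (u : M) :
  (forall c : R, c *: u = 0 -> c = 0) ->
  is_copy_of_ring [set x | exists c : R, x = c *: u].
Proof.
move=> u0; exists (scale_at u); split; last first.
  by apply/seteqP; split=> x [c]; [move=> _ <-; exists c | move=> ->; exists c].
move=> c d cd; apply/eqP; rewrite -subr_eq0; apply/eqP/u0.
by rewrite scalerBl; apply/eqP; rewrite subr_eq0; apply/eqP.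
Qed.

End DirectSums.

(** * Free summands and lengths of bracket quotients *)

Section Splitting.
Context {R : comNzRingType}.
Implicit Types (q k n a : nat) (A B I J N W : set R) (s : seq R).
Let D1 := additive_pow1 R.

(** This says that [R^a] is a direct summand of [R^{1/q}]: [v] is the image of the basis and [phi]
    the retraction. *)
Definition free_summand q a : Prop :=
  exists (phi : 'I_a -> R -> R) (v : 'I_a -> R),
  (forall i c x y, phi i (c ^+ q * x + y) = c * phi i x + phi i y) /\
  (forall i j, phi i (v j) = (i == j)%:R).

(* The [a] coordinate functions send [bracket q J] onto [J]. *)
Lemma chain_bracket q a J I k : free_summand q a -> submod 1 J ->
  chain 1 J I k -> chain q (bracket q J) (bracket q I) (a * k).
Proof.
case=> phi [v [phiL phiv]] Jsub.
have phi0 i : phi i 0 = 0.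
  have /esym/eqP := phiL i 1 0 0.
  by rewrite mulr0 addr0 mul1r -subr_eq0 addrK => /eqP.
have phiZ i c x : phi i (c ^+ q * x) = c * phi i x.
  by rewrite -[_ * _]addr0 phiL phi0 addr0.
have phiD i x y : phi i (x + y) = phi i x + phi i y.
  by have := phiL i 1 x y; rewrite expr1n !mul1r.
have phiN i N : submod 1 N -> bracket q N `<=` [set x | N (phi i x)].
  move=> Nsub x Nx; rewrite /= -[x]mul1r.
  apply: (@bracket_min _ q N [set x | forall c, N (phi i (c * x))] _ _ x Nx).
    split=> /= [c|b y z Ny Nz c]; first by rewrite mulr0 phi0;
      exact: (submod0 Nsub).
    by rewrite mulrDr phiD mulrA; apply: (submodD Nsub).
  by move=> z Nz c /=; rewrite mulrC phiZ mulrC; apply: submodMl.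
elim=> [C Csub JC|C C' {}k chC IH C'sub [CC' nC'C]].
  rewrite muln0; apply: chain0; last exact: bracketS.
  by apply: ideal_sub_submod; exact: submod_bracket.
have [u C'u nCu] : exists2 u, C' u & ~ C u.
  apply: contrapT => nu; apply: nC'C => u C'u; apply: contrapT => nCu.
  by apply: nu; exists u.
have Csub := chain_submod chC.
(* The sets [T j] refine the step from [C^[q]] to [C'^[q]] into [a] steps by releasing one
   coordinate at a time; [u^q v_j] separates [T (j + 1)] from [T j], its [j]-th coordinate being
   [u]. *)
pose T j := bracket q C' `&` [set x | forall i : 'I_a,
  (j <= i)%N -> C (phi i x)].
have Tsub j : submod q (T j).
  apply: submodI; first by apply: ideal_sub_submod; exact: submod_bracket.
  split=> /= [i _|c x y Cx Cy i ji]; first by rewrite phi0;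
    exact: (submod0 Csub).
  by rewrite phiL; apply: (submodD Csub); [apply: submodMl => //;
    apply: Cx | apply: Cy].
suff chT j : (j <= a)%N -> chain q (bracket q J) (T j) (a * k + j).
  rewrite mulnS addnC; apply: chainSr (chT a (leqnn a)) _ _.
    by apply: ideal_sub_submod; exact: submod_bracket.
  by move=> x [].
elim: j => [|j IHj] ja.
  rewrite addn0; apply: chainSr IH (Tsub _) _ => x Cx; split.
    exact: bracketS Cx.
  by move=> i _; apply: phiN Cx.
rewrite addnS; apply: chainS (IHj (ltnW ja)) (Tsub _) _; split.
  by move=> x [C'x Cx]; split=> // i ji; apply: Cx; apply: ltnW.
pose j' := Ordinal ja.
have /[swap]/[apply] : T j.+1 (u ^+ q * v j').
  split=> [|i ji /=].
    by rewrite mulrC; apply: submodMl (submod_bracket _ _) _;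
      apply: mem_bracket.
  rewrite phiZ phiv (_ : i == j' = false) ?mulr0; first exact: (submod0 Csub).
  by apply/eqP => ij; rewrite ij ltnn in ji.
by case=> _ /(_ j' (leqnn _)); rewrite phiZ phiv eqxx mulr1.
Qed.

End Splitting.

(** * The regular case *)

Section FrobeniusPowers.
Context {R : comNzRingType} (p : nat) (charRp : p \in [pchar R]) (m : set R).
Context (mloc : local_ideal m).
Let D1 := additive_pow1 R.

Lemma additive_pow_pchar e : additive_pow R (p ^ e).
Proof.
move=> a b; apply: exprDn_pchar.
by rewrite pnatX (eq_pnat _ (pcharf_eq charRp)) pnat_id ?(pcharf_prime charRp).
Qed.

Lemma pchar_gt1 : (1 < p)%N.
Proof. exact/prime_gt1/(pcharf_prime charRp). Qed.

Lemma residue_perfect_pow e : perfect_residue_field m p ->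
  residue_perfect m (p ^ e).
Proof.
have [msub _ _] := mloc; move=> perf.
have mpow w n : (0 < n)%N -> m w -> m (w ^+ n).
  by case: n => // n _ mw; rewrite exprSr; apply: submodMl.
elim: e => [|e IHe].
  exact: residue_perfect1.
move=> x; have [y mxy] := perf x; have [z myz] := IHe y.
exists z; rewrite expnSr exprM (_ : _ - _ = x - y ^+ p + (y - z ^+ (p ^ e)) ^+ p).
  apply: (submodD msub) => //; apply: mpow => //; exact: ltnW pchar_gt1.
have := powB (additive_pow_pchar 1) y (z ^+ (p ^ e)); rewrite expn1 => ->.
by ring.
Qed.

(** Coefficients over [p^e]-th powers are themselves expanded over [p]-th powers, so the products
    [b^(p^e) a] generate at the next level. *)
Lemma finite_pow e : F_finite R p ->
  exists s, setT `<=` adjoins (p ^ e) [set (0 : R)] s.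
Proof.
case=> t tgen.
have tT x : adjoins p [set 0] t x.
  by apply/adjoinsP; have [c ->] := tgen x; exists c; rewrite subrr.
elim: e => [|e [s sT]].
  by exists [:: 1] => x _; exists x; rewrite expn0 expr1 mulr1 subrr.
pose W := adjoins (p ^ e.+1) [set (0 : R)] [seq b ^+ (p ^ e) * a | a <- s,
  b <- t].
have D := additive_pow_pchar; have Wsub : submod (p ^ e.+1) W.
  by apply: submod_adjoins => //; exact: submod_0.
exists [seq b ^+ (p ^ e) * a | a <- s, b <- t] => x _; rewrite -/W.
have sW c a : a \in s -> W (c ^+ (p ^ e) * a).
  move=> sa.
  suff : adjoins p [set 0] t `<=` [set c | W (c ^+ (p ^ e) * a)] by apply;
    apply: tT.
  apply: adjoins_min => [|_ ->|b tb] /=; last first.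
  - by apply: mem_adjoins (submod_0 _) _ => //; apply: allpairs_f.
  - by rewrite (pow0 (D e)) mul0r; exact: (submod0 Wsub).
  split=> /= [|r y z Wy Wz]; first by rewrite (pow0 (D e)) mul0r;
    exact: (submod0 Wsub).
  rewrite D mulrDl; apply: (submodD Wsub) => //.
  by rewrite exprMn -exprM -expnS -mulrA; apply: submodZ.
have /adjoinsP[c /eqP] := sT x I; rewrite subr_eq0 => /eqP ->.
by apply: (submod_sum _ Wsub) => i _; apply: sW; apply: mem_nth.
Qed.

(** * Splitting when [R / m^[q]] has length exactly [q^d] *)

Section Complement.
Context (d : nat) (noethR : noetherian R) (FfinR : F_finite R p).
Context (lower : forall e t,
  length_le (p ^ e) (bracket (p ^ e) m) setT t -> ((p ^ e) ^ d <= t)%N).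
Context (upper : forall e,
  length_le (p ^ e) (bracket (p ^ e) m) setT ((p ^ e) ^ d)).

(** An ideal containing a power of each element of [m] contains some [m^[p^n]], because [n <= p^n];
    Krull's intersection theorem then applies. *)
Lemma bracket_local_separated c :
  (forall f, bracket (p ^ f) m c) -> c = 0.
Proof.
have [msub _ _] := mloc.
pose B := [set c : R | forall f, bracket (p ^ f) m c].
have Bsub : submod 1 B.
  split=> [f|a x y Bx By f]; first exact: (submod0 (submod_bracket _ _)).
  apply: (submodD (submod_bracket _ _)); last exact: By.
  by apply: (submodMl _ (submod_bracket _ _)); apply: Bx.
apply: (krull_intersection noethR mloc Bsub) => C Csub Cpow x Bx.
have [t mt] := noetherian_gen noethR msub.
have [||n Cn] := @uniform_exponent _ (fun y n => C (y ^+ n)) t.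
- by move=> z k n kn Cz; rewrite -(subnK kn) exprD; apply: submodMl.
- by move=> y yt; apply: Cpow; rewrite mt; apply: mem_adjoins (submod_0 1) yt.
suff: bracket (p ^ n) m `<=` C by apply; apply: Bx.
apply: bracket_min => // z; rewrite mt.
suff: adjoins 1 [set 0] t `<=` [set z | C (z ^+ (p ^ n))] by apply.
apply: adjoins_min; first exact: submod_preim_pow (additive_pow_pchar n) Csub.
  by move=> _ -> /=; rewrite (pow0 (additive_pow_pchar n));
    exact: (submod0 Csub).
move=> y yt /=; rewrite -(subnK (ltnW (ltn_expl n pchar_gt1))) exprD.
by apply: submodMl => //; apply: Cn.
Qed.

(* If [c ^ q u] lay in [V] for some [c] outside [bracket q' m], then
   [setT / bracket (q' q) m] would be too short. *)
Lemma complement_ex e u : ~ bracket (p ^ e) m u ->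
  exists V, [/\ submod (p ^ e) V, setT `<=` adjoin (p ^ e) V u &
    forall c, V (c ^+ (p ^ e) * u) -> c = 0].
Proof.
have [msub _ _] := mloc; have D := additive_pow_pchar.
have Ksub f g : submod (p ^ g) (bracket (p ^ f) m).
  by apply: ideal_sub_submod; exact: submod_bracket.
set q := (p ^ e)%N; move=> nKu; have De : additive_pow R q := D e.
have chu := chain_adjoin De (Ksub e e) nKu.
have [n nE] : exists n, (q ^ d = n.+1)%N.
  by exists (q ^ d).-1; rewrite prednK // expn_gt0 expn_gt0 (ltnW pchar_gt1).
set B := adjoin q _ _ in chu.
have Bsub : submod q B by apply: (submod_adjoin De); apply: Ksub.
(* Since [u] uses one unit of the length [q^d = n + 1], at most [n] further generators are needed
   modulo [m^[q]]. Nakayama's lemma then removes [m^[q]]. *)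
have [|s [size_s _ sT]] :=
  generators_of_length De (submodT q) Bsub (@subsetT _ _) (n := n).
  by apply: length_le_chain chu _; rewrite add1n -nE; apply: upper.
pose V := adjoins q [set 0] s; have Vsub : submod q V.
  by apply: submod_adjoins => //; exact: submod_0.
have Wsub : submod q (adjoin q V u) by apply: (submod_adjoin De).
have VuT : setT `<=` adjoin q V u.
  have [s0 s0T] := finite_pow e FfinR.
  apply: (nakayama mloc (s := s0) De Wsub) => // [x _|N Nsub WN mN].
    by apply: adjoinsS (s0T x I) => _ ->; exact: (submod0 Wsub).
  apply: subset_trans sT _; apply: adjoins_min => // [|v sv].
    apply: adjoin_min => // [x Kx|]; last by apply: WN; apply: mem_adjoin.
    rewrite -[x]mul1r.
    apply: (@bracket_min _ q m [set x | forall c, N (c * x)] _ _ x Kx) =>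
      [|z mz c] /=.
      split=> /= [c|a y z Ny Nz c]; first by rewrite mulr0;
        exact: (submod0 Nsub).
      by rewrite mulrDr mulrA; apply: (submodD Nsub).
    by rewrite mulrC; apply: mN.
  by apply: WN; apply: sub_adjoin => //; apply: mem_adjoins => //;
    exact: submod_0.
exists V; split=> // c Vc; apply: bracket_local_separated => f;
  apply: contrapT => nKc.
set q' := (p ^ f)%N in nKc *; have Df : additive_pow R q' := D f.
have [t tE] : exists t, (q' ^ d = t.+1)%N.
  by exists (q' ^ d).-1; rewrite prednK // expn_gt0 expn_gt0 (ltnW pchar_gt1).
have le' : length_le q' (adjoin q' (bracket q' m) c) setT t.
  apply: length_le_chain (chain_adjoin Df (Ksub f f) nKc) _.
  by rewrite add1n -tE; apply: upper.
have KN z a : bracket q' m a -> bracket (q' * q) m (a ^+ q * z).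
  move=> Ka; rewrite mulrC -(bracketM _ _ De).
  by apply: submodMl (submod_bracket _ _) _; apply: mem_bracket.
have Qsub : submod q (bracket (q' * q) m).
  by apply: ideal_sub_submod; exact: submod_bracket.
pose V' := adjoins q (bracket (q' * q) m) s.
have V'sub : submod q V' by apply: submod_adjoins.
have VV' : V `<=` V' by apply: adjoinsS => _ ->; exact: (submod0 Qsub).
have leV' : length_le (q' * q) (bracket (q' * q) m) V' (size s * t.+1).
  apply: (length_le_adjoins De Df Qsub (Ksub f f)) => [z _ a|].
    exact: KN.
  by rewrite -tE; apply: upper.
(* As [c^q u] lies in [V], the factor generated by [u] is a quotient of [R / (m^[q'] + (c))], whose
   length is at most [t = q'^d - 1]. The total [n (t + 1) + t] is then smaller than
   [(n + 1) (t + 1) = (q q')^d]. *)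
have leU : length_le (q' * q) V' (adjoin q V' u) t.
  apply: (length_le_cyclic De Df _ _ le').
    by apply: (submod_adjoin Df); apply: Ksub.
  move=> a [r Kar].
  rewrite (_ : a ^+ q * u = (a - r ^+ q' * c) ^+ q * u + r ^+ (q' * q) * (c ^+ q * u)).
    apply: (submodD V'sub); first exact: (sub_adjoins De _ (KN _ _ Kar)).
    by rewrite exprM; apply: submodZ => //; apply: VV'.
  by rewrite (powB De) exprMn -exprM; ring.
have VT : setT `<=` adjoin q V' u.
  by move=> x _; apply: adjoinS VV' _ _; apply: VuT.
have /lower : length_le (p ^ (f + e)) (bracket (p ^ (f + e)) m) setT (size s * t.+1 + t).
  rewrite expnD -/q -/q'; apply: length_le_trans leV' _ => //.
  - exact: additive_powM.
  - exact: submod_powr.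
  - exact: submod_powr.
  - exact: sub_adjoins.
  apply: length_leSr leU => //; exact/submod_powr/submod_adjoin.
rewrite expnD -/q -/q' expnMn tE nE.
have : (size s * t.+1 <= n * t.+1)%N by rewrite leq_mul2r size_s orbT.
by lia.
Qed.

Lemma free_summand_qroots e a :
  ring_copies (qroots charRp e) a -> free_summand (R := R) (p ^ e) a.
Proof. exact: ring_copies_coordinates. Qed.

(** By Nakayama's lemma a nonzero summand has an element [u] outside [m^[q] = m R^{1/q}]. With [V] a
    complement of [R u], the modular law gives [N i = R u + (N i :&: V)], and indecomposability
    kills the second term. *)
Lemma indecomposable_summand_cyclic e n (N : 'I_n -> set (qroots charRp e)) i :
  internal_direct_sum N -> indecomposable (N i) ->
  exists2 u : qroots charRp e, (forall c : R, c *: u = 0 -> c = 0) &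
    N i = [set x | exists c : R, x = c *: u].
Proof.
move=> sumN [Nsub Nn0 Nind]; set q := (p ^ e)%N.
have De : additive_pow R q by exact: additive_pow_pchar.
have [pr [prN _ prL prE]] := internal_direct_sum_proj sumN.
pose f (x : R) : R := pr i x; pose Ni : set R := N i.
have fL a x y : f (a ^+ q * x + y) = a ^+ q * f x + f y by exact: prL.
have fN x : Ni (f x) by exact: prN.
have fE x : Ni x -> f x = x by move=> Nx; rewrite /f (prE i) // eqxx.
have {}Nsub : submod q Ni by exact: Nsub.
have [s0 s0T] := finite_pow e FfinR.
have f0 : f 0 = 0 by apply: fE; exact: (submod0 Nsub).
have fD x y : f (x + y) = f x + f y by have := fL 1 x y; rewrite expr1n !mul1r.
have fZ a x : f (a ^+ q * x) = a ^+ q * f x.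
  by have := fL a x 0; rewrite f0 !addr0.
have [u Nu nKu] : exists2 u, Ni u & ~ bracket q m u.
  apply: contrapT => nu; apply: Nn0; apply/seteqP; split; last first.
    by move=> _ ->; exact: (submod0 Nsub).
  have NK x : Ni x -> bracket q m x.
    by move=> Nx; apply: contrapT => nKx; apply: nu; exists x.
  apply: (nakayama mloc (s := [seq f x | x <- s0]) De (submod_0 q)).
  - by move=> _ /mapP[x _ ->].
  - move=> x Nx; rewrite -(fE x Nx).
    set W := adjoins q [set 0] _.
    have Wsub : submod q W by apply: (submod_adjoins De); exact: submod_0.
    suff: adjoins q [set 0] s0 `<=` [set x | W (f x)] by apply; apply: s0T.
    apply: adjoins_min => [|_ ->|y ys0] /=.
    + split=> /= [|a y z Wy Wz]; first by rewrite f0; exact: (submod0 Wsub).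
      by rewrite fL; case: Wsub => _; apply.
    + by rewrite f0; exact: (submod0 Wsub).
    + by apply: (mem_adjoins De (submod_0 q)); apply: map_f.
  (* The projection [f] turns [N i <= m R^{1/q}] into [N i <= m (N i)]. *)
  - move=> B Bsub _ mB x Nx; rewrite -(fE x Nx) -[x]mul1r.
    apply: (@bracket_min _ q m [set x | forall c, B (f (c * x))] _ _
      x (NK x Nx)) => [|z mz c] /=.
      split=> /= [c|a y z By Bz c]; first by rewrite mulr0 f0;
        exact: (submod0 Bsub).
      by rewrite mulrDr mulrA fD; apply: (submodD Bsub).
    by rewrite mulrC fZ; apply: mB.
have [V [Vsub VT Vu]] := complement_ex nKu.
have u0 (c : R) : c ^+ q * u = 0 -> c = 0.
  by move=> cu0; apply: Vu; rewrite cu0; exact: (submod0 Vsub).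
exists u; first exact: u0.
have [||||U0|NV0] := Nind [set x | exists c : R,
  x = c *: (u : qroots charRp e)] (Ni `&` V).
- split=> [|a _ _ [b ->] [c ->]]; first by exists 0; rewrite scale0r.
  by exists (a * b + c); rewrite scalerDl scalerA.
- exact: submodI.
- apply/seteqP; split=> [x [[c xE] [_ Vx]]|_ ->]; last first.
    split; first by exists 0; rewrite scale0r.
    by split; [exact: (submod0 Nsub) | exact: (submod0 Vsub)].
  by rewrite xE (Vu c) ?scale0r //; move: Vx; rewrite xE.
- apply/seteqP; split=> [_ [_ [c ->] [y [Ny _] <-]]|x Nx].
    by apply: (submodD Nsub) => //; apply: (submodZ c Nsub Nu).
  have [c Vc] := VT x I.
  exists (c *: (u : qroots charRp e)); first by exists c.
  exists (x - c ^+ q * u); last by rewrite addrC; exact: subrK.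
  by split=> //; apply: (submodB De Nsub Nx); apply: (submodZ c Nsub Nu).
- case: (nKu); suff -> : u = 0 by exact: (submod0 (submod_bracket _ _)).
  have : [set x | exists c : R, x = c *: (u : qroots charRp e)] u.
    by exists 1; rewrite scale1r.
  by rewrite U0.
apply/seteqP; split=> [x Nx|_ [c ->]]; last exact: (submodZ c Nsub Nu).
have [c Vc] := VT x I; exists c; apply/eqP; rewrite -subr_eq0; apply/eqP.
suff : (Ni `&` V) (x - c ^+ q * u) by rewrite NV0.
by split=> //; apply: (submodB De Nsub Nx); apply: (submodZ c Nsub Nu).
Qed.

(** The free summands bound [a] by the length of [R / m^[q]]. Conversely all [n] summands are free
    and cyclic, so [a = n], and their generators bound that length by [n]. *)
Lemma ring_copies_qroots e a :
  ring_copies (qroots charRp e) a -> a = ((p ^ e) ^ d)%N.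
Proof.
move=> copies; have De := additive_pow_pchar e; have [msub m1 _] := mloc.
apply/eqP; rewrite eqn_leq; apply/andP; split.
  apply: upper; rewrite -[a]muln1.
  have ch : chain 1 m setT 1.
    by apply: chainS (chain0 msub (@subset_refl _ _)) (submodT 1) _;
      split=> // /(_ 1 I).
  apply: chainSr (chain_bracket (free_summand_qroots copies) msub ch) (submodT _) _.
  exact: subsetT.
case: copies => n [N [sumN Nind ->]].
have /choice[u uP] i : exists u : qroots charRp e,
    (forall c : R, c *: u = 0 -> c = 0) /\ N i = [set x | exists c : R,
      x = c *: u].
  by have [u u0 NE] := indecomposable_summand_cyclic sumN (Nind i); exists u.
rewrite (_ : [set i | _]%SET = [set: 'I_n]%SET); last first.
  apply/setP => i; rewrite !inE; apply/asboolP.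
  by have [u0 ->] := uP i; apply: cyclic_is_copy_of_ring.
rewrite cardsT card_ord; apply: lower.
have Ksub := submod_bracket (p ^ e) m.
pose s : seq R := [seq u i | i <- enum 'I_n].
have le : length_le (1 * p ^ e) (bracket (p ^ e) m)
    (adjoins (p ^ e) (bracket (p ^ e) m) s) (size s * 1).
  apply: (length_le_adjoins De D1 (ideal_sub_submod _ Ksub) msub) =>
    [z _ c mc|].
    by rewrite mulrC; apply: (submodMl _ Ksub); apply: mem_bracket.
  exact: length_le_residue mloc _ D1 (residue_perfect1 msub).
rewrite mul1n muln1 size_map size_enum_ord in le.
have Wsub := submod_adjoins De s (ideal_sub_submod (p ^ e) Ksub).
apply: (length_leSr Wsub _ le) => x _.
have [pr [prN prS _ _]] := internal_direct_sum_proj sumN.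
rewrite (prS x); apply: (submod_sum _ Wsub) => i _.
have := prN i x; have [_ ->] := uP i => -[c ->].
apply: (submodZ c Wsub); apply: (mem_adjoins De (ideal_sub_submod _ Ksub)).
by apply: map_f; rewrite mem_enum.
Qed.

End Complement.
End FrobeniusPowers.

(** * Signature one *)

Section IndependentSequences.
Context {R : comNzRingType} (n : nat).
Implicit Types (f g b c : 'I_n -> R) (P : pred 'I_n).
Let D1 := additive_pow1 R.

Definition lincomb P f : set R := [set x | exists c,
  x = \sum_(i | P i) c i * f i].

(** With [I] the ideal generated by [f], this says that [I / I^2] is free over [R / I] on the
    classes of the [f i]. *)
Definition lech_independent f : Prop :=
  forall b, \sum_i b i * f i = 0 -> forall i, lincomb predT f (b i).

Lemma submod_lincomb P f : submod 1 (lincomb P f).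
Proof.
split=> [|a _ _ [b ->] [c ->]].
  by exists (fun=> 0); rewrite big1 // => i _; rewrite mul0r.
exists (fun i => a * b i + c i); rewrite mulr_sumr -big_split /=.
by apply: eq_bigr => i _; rewrite mulrDl mulrA.
Qed.

Lemma mem_lincomb P f i : P i -> lincomb P f (f i).
Proof.
move=> Pi; exists (fun j => (j == i)%:R); rewrite (bigD1 i) //= eqxx mul1r.
by rewrite big1 ?addr0 // => j /andP[_ /negPf->]; rewrite mul0r.
Qed.

Lemma lincomb_min P f (A : set R) : submod 1 A -> (forall i, P i -> A (f i)) ->
  lincomb P f `<=` A.
Proof.
move=> Asub fA _ [c ->]; apply: (submod_sum _ Asub) => i Pi.
by apply: submodMl => //; apply: fA.
Qed.

Lemma lincombE f i0 :
  lincomb predT f = adjoin 1 (lincomb (predC1 i0) f) (f i0).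
Proof.
apply/seteqP; split.
  apply: lincomb_min => [|i _];
    first exact: (submod_adjoin D1 _ (submod_lincomb _ _)).
  have [->|ii0] := eqVneq i i0; first exact: mem_adjoin (submod_lincomb _ _).
  by apply: (sub_adjoin D1); apply: mem_lincomb.
apply: adjoin_min (submod_lincomb _ _) _ _; last exact: mem_lincomb.
by apply: lincomb_min => [|i _]; [exact: submod_lincomb | exact: mem_lincomb].
Qed.

Section Step.
Context (f g : 'I_n -> R) (i0 : 'I_n) (q : nat) (q_gt0 : (0 < q)%N).
Context (fi0 : f i0 = g i0 ^+ q) (fg : forall i, i != i0 -> f i = g i).
Context (indf : lech_independent f).

Let lincomb_sub : lincomb predT f `<=` lincomb predT g.
Proof.
apply: lincomb_min => [|i _]; first exact: submod_lincomb.
have [->|ii0] := eqVneq i i0; last by rewrite fg //; apply: mem_lincomb.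
rewrite fi0 -(prednK q_gt0) exprSr; apply: submodMl;
  first exact: submod_lincomb.
exact: mem_lincomb.
Qed.

Lemma lech_independent_root : lech_independent g.
Proof.
(* Multiplying the relation by [g i0 ^+ q.-1] turns it into a relation among the [f i], which places
   [b i0] in their ideal. *)
move=> b b0; pose b' i := if i == i0 then b i0 else g i0 ^+ q.-1 * b i.
have : \sum_i b' i * f i = 0.
  transitivity (g i0 ^+ q.-1 * \sum_i b i * g i); last by rewrite b0 mulr0.
  rewrite mulr_sumr; apply: eq_bigr => i _.
  rewrite /b'; case: eqVneq => [->|/fg->]; last by rewrite mulrA.
  by rewrite fi0 -{1}(prednK q_gt0) exprSr; ring.
move=> /indf bf; have := bf i0; rewrite /b' eqxx => bi0 i.
have [->|ii0] := eqVneq i i0; first exact: lincomb_sub.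
have [c bi0E] := bi0.
(* Substituting the expansion of [b i0] into the original relation gives a second relation among the
   [f j]. *)
pose b'' j := c j * g i0 + (if j == i0 then 0 else b j).
have : \sum_j b'' j * f j = 0.
  transitivity (\sum_i b i * g i); last exact: b0.
  rewrite [RHS](bigD1 i0) //= bi0E mulr_suml [X in _ + X]big_mkcond -big_split /=.
  apply: eq_bigr => j _; rewrite /b'' mulrDl; congr (_ + _); first by ring.
  by case: eqVneq => [_|/fg->]; rewrite ?mul0r.
move=> /indf/(_ i)/lincomb_sub;
  rewrite /b'' (negPf ii0) addrC -[X in _ + X]opprK.
have gsub := submod_lincomb predT g.
apply: (submodBr gsub); apply: (submodN D1 gsub); apply: (submodMl _ gsub).
exact: mem_lincomb.
Qed.

(** With [h = g i0]: if [h^j x - r h^(j+1)] lies in the ideal of the other [g i], multiplying by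
    [h^(q-j)] gives a relation in which [f i0] has coefficient [x - r h]. Independence then yields
    the colon condition of [chain_pow]. *)
Lemma chain_lech_root t : chain 1 (lincomb predT g) setT t ->
  chain 1 (lincomb predT f) setT (q * t).
Proof.
have Isub := submod_lincomb (predC1 i0) g.
have IE : lincomb (predC1 i0) f = lincomb (predC1 i0) g.
  apply/seteqP; split=> x [c xE]; exists c; rewrite xE; apply: eq_bigr => i ii0.
    by rewrite fg.
  by rewrite fg.
rewrite (lincombE g i0) (lincombE f i0) IE fi0.
apply: chain_pow => // j x jq [r [c xE]].
pose b i := if i == i0 then x - r * g i0 else - g i0 ^+ (q - j) * c i.
have : \sum_i b i * f i = 0.
  rewrite (bigD1 i0) //= {1}/b eqxx fi0.
  rewrite (eq_bigr (fun i => - g i0 ^+ (q - j) * (c i * g i))) => [|i ii0].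
    rewrite -mulr_sumr -xE expr1 -{1}(subnK (ltnW jq)) exprD exprS; ring.
  by rewrite /b (negPf ii0) fg // mulrA.
move=> /indf/(_ i0); rewrite /b eqxx (lincombE f i0) IE fi0 => mem.
have gsub := submod_adjoin D1 (g i0) Isub; have gmem := mem_adjoin (q :=
  1) (g i0) Isub.
apply: (@submodBr _ 1 _ _ (r * g i0)) => //; first exact: submodMl.
move: mem; apply: adjoin_min => //; first exact: sub_adjoin.
by rewrite -(prednK q_gt0) exprSr; apply: submodMl.
Qed.

End Step.

Lemma chain_lech (y : 'I_n -> R) q : (0 < q)%N ->
  ~ lincomb predT y 1 -> lech_independent (fun i => y i ^+ q) ->
  chain 1 (lincomb predT (fun i => y i ^+ q)) setT (q ^ n).
Proof.
move=> q_gt0 y1 ind.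
(* Roots are extracted one index at a time, each contributing a factor [q]; at [k = n] the ideal is
   that of [y], of colength at least one. *)
pose f k (i : 'I_n) := y i ^+ (if (i < k)%N then 1%N else q).
suff ch j k : (k + j = n)%N -> lech_independent (f k) ->
    chain 1 (lincomb predT (f k)) setT (q ^ j) by exact: (ch n 0%N).
elim: j k => [|j IHj] k.
  rewrite addn0 => kn _.
  have -> : f k = y by apply/funext => i; rewrite /f kn ltn_ord expr1.
  apply: chainS (chain0 (submod_lincomb _ _) (@subset_refl _ _)) (submodT 1) _.
  by split=> // /(_ 1 I).
move=> kn indf; have kn' : (k < n)%N by rewrite -kn addnS ltnS leq_addr.
pose i0 := Ordinal kn'.
have fi0 : f k i0 = f k.+1 i0 ^+ q by rewrite /f /= ltnn ltnSn expr1.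
have fE i : i != i0 -> f k i = f k.+1 i.
  by move=> ii0; rewrite /f ltnS [in RHS]leq_eqVlt (negPf (ii0 : val i != k)).
rewrite expnS; apply: (chain_lech_root q_gt0 fi0 fE indf).
apply: IHj; first by rewrite -kn addSnnS.
exact: lech_independent_root q_gt0 fi0 fE indf.
Qed.

End IndependentSequences.

(** * Length estimates when the signature is one *)

Section Forward.
Context {R : comNzRingType} (p : nat) (charRp : p \in [pchar R]) (m : set R).
Context (mloc : local_ideal m) (perf : perfect_residue_field m p).
Let D1 := additive_pow1 R.
Let D e : additive_pow R (p ^ e) := additive_pow_pchar charRp e.
Let p_gt1 := pchar_gt1 charRp.

(** Divide the inequality by [(p^e)^d] and pass to the limit: [a e] contributes [1] and [a e.+1]
    contributes [p^d]. *)
Lemma copies_limit (K : realType) (a : nat -> nat) d alpha beta gamma e0 :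
  (fun e => (a e)%:R / ((p ^ e)%N%:R ^+ d) : K) @ \oo --> (1 : K) ->
  (forall e, (e0 <= e)%N ->
    alpha * a e + beta * a e.+1 <= gamma * (p ^ e.+1) ^ d)%N ->
  (alpha + beta * p ^ d <= gamma * p ^ d)%N.
Proof.
move=> lim1 le; set u := (fun e => _ : K) in lim1.
have lim2 : (fun e => u e.+1) @ \oo --> (1 : K) by rewrite cvg_shiftS.
pose w e := alpha%:R * u e + (beta * p ^ d)%N%:R * u e.+1.
have limw : w @ \oo --> (alpha%:R * 1 + (beta * p ^ d)%N%:R * 1 : K).
  by apply: cvgD; apply: cvgM => //; apply: cvg_cst.
rewrite -(ler_nat K) natrD -[alpha%:R]mulr1 -[(beta * _)%N%:R]mulr1.
rewrite -(cvg_lim _ limw) //; apply: limr_le; first by apply/cvg_ex; eexists;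
  exact: limw.
exists e0 => // e /= ee0; rewrite /w /u.
have pe0 k : 0 < (p ^ k)%N%:R ^+ d :> K.
  by rewrite exprn_gt0 // ltr0n expn_gt0 (ltnW p_gt1).
have pS : (p ^ e.+1)%N%:R ^+ d = (p ^ d)%N%:R * (p ^ e)%N%:R ^+ d :> K.
  by rewrite expnS natrM exprMn (natrX _ p d).
have pd0 : (p ^ d)%N%:R != 0 :> K by rewrite pnatr_eq0 -lt0n expn_gt0 (ltnW p_gt1).
have pe1 := lt0r_neq0 (pe0 e).
rewrite -(ler_pM2r (pe0 e)).
have -> : (alpha%:R * ((a e)%:R / (p ^ e)%N%:R ^+ d) +
    (beta * p ^ d)%N%:R * ((a e.+1)%:R / (p ^ e.+1)%N%:R ^+ d)) * (p ^ e)%N%:R ^+ d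
    = (alpha * a e + beta * a e.+1)%N%:R :> K.
  by rewrite pS natrD !natrM; field; rewrite pd0 pe1.
have -> : (gamma * p ^ d)%N%:R * (p ^ e)%N%:R ^+ d = (gamma * (p ^ e.+1) ^ d)%N%:R :> K.
  by rewrite !natrM -mulrA -pS (natrX _ (p ^ e.+1) d).
by rewrite ler_nat le.
Qed.

Lemma colength_exact q (J : set R) n : additive_pow R q -> submod q J ->
  length_le q J setT n -> exists l, length_le q J setT l /\ chain q J setT l.
Proof.
move=> qD Jsub len.
have exl : exists l, `[< length_le q J setT l >] by exists n; apply/asboolP.
case: (ex_minnP exl) => l /asboolP lel lmin; exists l; split=> //.
case: l lel lmin => [|l] lel lmin; first exact: chain0.
have [k lk chk] : exists2 k, (l < k)%N & chain q J setT k.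
  apply: contrapT => nk;
    suff /asboolP/lmin : length_le q J setT l by rewrite ltnn.
  by move=> k chk; rewrite leqNgt; apply/negP => lk; apply: nk; exists k.
exact: chain_leq chk.
Qed.

(** [I^[q]] contains the [q]-th powers of the generators, whose ideal has colength at most
    [q^(size s) l]; perfectness carries this over to [q]-th power scalars. *)
Lemma length_le_bracket_adjoins e s l :
  length_le 1 (adjoins 1 [set (0 : R)] s) setT l ->
  length_le (p ^ e) (bracket (p ^ e) (adjoins 1 [set 0] s)) setT
    ((p ^ e) ^ size s * l).
Proof.
move=> les; have sub0 t := submod_adjoins D1 t (submod_0 (R := R) 1).
apply: (@length_leSl _ _ (adjoins 1 [set 0] [seq x ^+ (p ^ e) | x <- s])).
  apply: adjoins_min => [|_ ->|_ /mapP[x xs ->]].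
  - by apply: submod_bracket.
  - exact: (submod0 (submod_bracket _ _)).
  - by apply: mem_bracket; apply: (mem_adjoins D1 (submod_0 1)).
apply: (length_le_restrict mloc (D e)); first exact: residue_perfect_pow.
  exact: sub0.
exact: length_le_adjoins_pow (submod_0 1) les.
Qed.

Lemma chain_sub_local (J : set R) : submod 1 J -> J `<=` m -> forall l,
  chain 1 J setT l.+1 -> chain 1 J m l.
Proof.
move=> Jsub Jm l ch; have [msub _ _] := mloc.
have [k1 [k2 [lk ch1 ch2]]] := chain_split D1 Jsub msub Jm ch.
have k2_le1 : (k2 <= 1)%N.
  apply: (length_le_residue mloc D1 (residue_perfect1 msub)).
  exact: chainSr ch2 (submodT 1) (@subsetT _ _).
apply: (@chain_leq _ _ _ _ k1); first by lia.
by apply: (chainSr ch1 msub) => x [].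
Qed.

Section SignatureOne.
Context (K : realType) (a : nat -> nat) (d : nat).
Context (free : forall e, free_summand (R := R) (p ^ e) (a e)).
Context (lim1 : (fun e =>
  (a e)%:R / ((p ^ e)%N%:R ^+ d) : K) @ \oo --> (1 : K)).

(** With fewer than [d] generators, [a e <= q^(size s)] would force [a e / q^d] to tend to [0]. *)
Lemma generators_ge s : m = adjoins 1 [set 0] s -> (d <= size s)%N.
Proof.
move=> ms; have [msub m1 _] := mloc; rewrite leqNgt; apply/negP => sd.
have ae e : (a e <= (p ^ e) ^ size s)%N.
  have ch : chain 1 m setT 1.
    by apply: chainS (chain0 msub (@subset_refl _ _)) (submodT 1) _;
      split=> // /(_ 1 I).
  have le : length_le (p ^ e) (bracket (p ^ e) m) setT ((p ^ e) ^ size s * 1).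
    rewrite [X in bracket _ X]ms; apply: length_le_bracket_adjoins; rewrite -ms.
    exact: (length_le_residue mloc D1 (residue_perfect1 msub)).
  rewrite -[a e]muln1 -[X in (_ <= X)%N]muln1; apply: le.
  exact: chainSr (chain_bracket (free e) msub ch) (submodT _) (@subsetT _ _).
(* For [e >= 1], [2 a e <= q a e <= q^d]; in the limit these constants give the absurd
   [2 p^d <= p^d]. *)
have := @copies_limit K a d (2 * p ^ d) 0 1 1 lim1.
have pd0 : (0 < p ^ d)%N by rewrite expn_gt0 (ltnW p_gt1).
have le e : (1 <= e)%N -> (2 * p ^ d * a e + 0 * a e.+1 <= 1 * (p ^ e.+1) ^ d)%N.
  move=> e1; rewrite mul0n addn0 mul1n expnS expnMn [(2 * _)%N]mulnC -mulnA leq_mul2l.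
  apply/orP; right.
  apply: (@leq_trans (p ^ e * (p ^ e) ^ size s)).
    apply: leq_mul => //; apply: leq_trans p_gt1 _.
    by rewrite -[X in (X <= _)%N]expn1 leq_pexp2l // ltnW.
  by rewrite -expnS leq_pexp2l // expn_gt0 (ltnW p_gt1).
by move=> /(_ le); lia.
Qed.

Section RegularSequence.
Context (X : set R) (l : nat) (Xsub : submod 1 X) (Xm : X `<=` m).
Context (leX : forall e,
  length_le (p ^ e) (bracket (p ^ e) X) setT ((p ^ e) ^ d * l.+1)).
Context (chX : chain 1 X setT l.+1).

(** Of the length at most [q^d (l + 1)] of [R / X^[q]], the part [m^[q] / X^[q]] takes at least
    [a e * l]. *)
Lemma colength_bracket_local e k :
  chain (p ^ e) (bracket (p ^ e) m) setT k ->
  (a e * l + k <= (p ^ e) ^ d * l.+1)%N.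
Proof.
move=> ch; apply: leX; apply: chain_cat ch.
by apply: chain_bracket => //; apply: chain_sub_local.
Qed.

Lemma colength_bracket_bracket e (J : set R) k : submod 1 J ->
  chain 1 (bracket p m) J k ->
  chain (p ^ e.+1) (bracket (p ^ e.+1) m) (bracket (p ^ e) J) (a e * k).
Proof.
move=> Jsub ch; rewrite expnS -(bracketM _ _ (D e)) mulnC; apply: chain_powl.
exact: chain_bracket (free e) (submod_bracket _ _) ch.
Qed.

(** The free summands lift the chain to one of length [a e * k] over [m^[pq]]. The previous bound
    then reads [k + l p^d <= (l + 1) p^d] in the limit. *)
Lemma colength_bracket_p k : chain 1 (bracket p m) setT k -> (k <= p ^ d)%N.
Proof.
move=> ch.
have le e : (0 <= e)%N -> (k * a e + l * a e.+1 <= l.+1 * (p ^ e.+1) ^ d)%N.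
  move=> _; rewrite mulnC addnC [(l * _)%N]mulnC [(l.+1 * _)%N]mulnC.
  apply: colength_bracket_local.
  apply: chainSr (colength_bracket_bracket e (submodT 1) ch) (submodT _) _.
  exact: subsetT.
by have := copies_limit lim1 le; lia.
Qed.

Section Relation.
Context (n : nat) (y : 'I_n -> R) (ym : m = lincomb predT y).
Context (M2 : set R) (M2sub : submod 1 M2).
Context (mM2 : forall z w, m z -> m w -> M2 (z * w)).
Context (chM2 : chain 1 M2 m n).

(* A relation [\sum_i b i * y i ^+ p = 0] with [b i0] outside [bracket p m]
   would shorten [bracket Q m / bracket Q M2] by about [q ^ d], [Q = p q]. *)
Lemma bracket_generators_independent : lech_independent (fun i => y i ^+ p).
Proof.
move=> b b0 i0; have [msub m1 _] := mloc.
have yim i : m (y i) by rewrite ym; apply: mem_lincomb.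
suff : bracket p m (b i0).
  apply: (bracket_min (submod_lincomb _ _)) => z; rewrite ym.
  have pD : additive_pow R p by have := D 1; rewrite expn1.
  suff : lincomb predT y `<=` [set z | lincomb predT (fun i =>
    y i ^+ p) (z ^+ p)] by apply.
  apply: lincomb_min; first exact: submod_preim_pow pD (submod_lincomb _ _).
  by move=> i _ /=; apply: (@mem_lincomb _ _ predT (fun i => y i ^+ p)).
apply: contrapT => nb.
have le e : (0 <= e)%N ->
    (1 * a e + (n * l.+1) * a e.+1 <= (n * l.+1) * (p ^ e.+1) ^ d)%N.
  move=> _; set Q := (p ^ e.+1)%N; set q := (p ^ e)%N.
  have QD : additive_pow R Q := D e.+1.
  have qD : additive_pow R q := D e.
  have Qsub (J : set R) : submod Q (bracket Q J).
    by apply: ideal_sub_submod; exact: submod_bracket.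
  have lem : length_le Q (bracket Q m) setT ((p ^ e.+1) ^ d * l.+1).
    exact: length_leSl (bracketS Xm) (@leX e.+1).
  have [lam [le_lam ch_lam]] := colength_exact QD (Qsub m) lem.
  have lam_le := colength_bracket_local ch_lam.
  (* As [b i0] is outside [m^[p]], the quotient [K' / m^[Q]] has length at least [a e], so [R / K']
     has length at most [lam - a e]. *)
  pose K' := adjoin 1 (bracket Q m) (b i0 ^+ q).
  have K'sub : submod 1 K' by exact: (submod_adjoin D1 _ (submod_bracket _ _)).
  have chK : chain Q (bracket Q m) K' (a e).
    rewrite -[a e]muln1.
    have ch1 := chain_adjoin D1 (submod_bracket p m) nb.
    apply: chainSr (colength_bracket_bracket e (chain_submod ch1) ch1) _ _.
      exact: ideal_sub_submod.
    have := @bracket_adjoin _ _ (bracket p m) (b i0) (D e).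
    by rewrite (bracketM _ _ (D e)) -expnS.
  have ae_lam : (a e <= lam)%N.
    by apply: le_lam; apply: chainSr chK (submodT _) (@subsetT _ _).
  have leK : length_le Q K' setT (lam - a e).
    by apply: length_le_chain chK _; rewrite subnKC.
  pose N0 := bracket Q M2; have N0sub : submod 1 N0 := submod_bracket _ _.
  pose s := [seq y j ^+ Q | j <- enum (predC1 i0)].
  pose V := adjoins 1 N0 s;
    have Vsub : submod 1 V by exact: (submod_adjoins D1).
  have size_s : (size s).+1 = n.
    by rewrite size_map -cardE cardC1 card_ord prednK // (leq_trans _ (ltn_ord i0)).
  have leV : length_le Q N0 V (size s * lam).
    rewrite -[Q]muln1.
    apply: (length_le_adjoins D1 QD N0sub (Qsub m)) => // _ /mapP[j _ ->] c mc.
    suff : bracket Q m `<=` [set c | N0 (c * y j ^+ Q)] by apply.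
    apply: bracket_min => [|z mz /=]; first exact: (submod_preimMr (q := 1)).
    by rewrite -exprMn; apply: mem_bracket; apply: mM2.
  (* This is the [q]-th power of the relation. It makes the factor generated by [y i0 ^+ Q] a
     quotient of [R / K']. *)
  have bV : V (b i0 ^+ q * y i0 ^+ Q).
    have : V ((b i0 * y i0 ^+ p) ^+ q).
      move: b0; rewrite (bigD1 i0) //= => /eqP; rewrite addr_eq0 => /eqP ->.
      rewrite (powN qD); apply: (submodN D1 Vsub).
      apply: (submod_sum (q := 1) (N := [set x | V (x ^+ q)])) => [|j ji0].
        exact: submod_preim_pow.
      rewrite /= exprMn; apply: (submodMl _ Vsub); rewrite -exprM -expnS.
      apply: (mem_adjoins D1 N0sub); apply/mapP; exists j => //.
      by rewrite mem_enum.
    by rewrite exprMn -exprM -expnS.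
  have leU : length_le Q V (adjoin 1 V (y i0 ^+ Q)) (lam - a e).
    rewrite -[X in length_le X]muln1.
    apply: (length_le_cyclic D1 QD (ideal_sub_submod _ K'sub) _ leK).
    move=> c [r Kc]; rewrite !expr1 in Kc *.
    rewrite (_ : _ * _ = (c - r * b i0 ^+ q) * y i0 ^+ Q + r * (b i0 ^+ q * y i0 ^+ Q)).
      apply: (submodD Vsub); last exact: submodMl.
      apply: (sub_adjoins D1).
      suff : bracket Q m `<=` [set c | N0 (c * y i0 ^+ Q)] by apply.
      apply: bracket_min => [|z mz /=]; first exact: (submod_preimMr (q := 1)).
      by rewrite -exprMn; apply: mem_bracket; apply: mM2.
    by ring.
  have Usub : submod 1 (adjoin 1 V (y i0 ^+ Q)) by exact: (submod_adjoin D1).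
  have leN0 : length_le Q N0 (adjoin 1 V (y i0 ^+ Q)) (size s * lam + (lam - a e)).
    apply: length_le_trans leV leU => //.
    - exact: ideal_sub_submod.
    - exact: ideal_sub_submod.
    - exact: (sub_adjoins D1).
    - exact: (sub_adjoin D1).
    - exact: ideal_sub_submod.
  have mU : bracket Q m `<=` adjoin 1 V (y i0 ^+ Q).
    apply: bracket_min => // z; rewrite ym.
    suff : lincomb predT y `<=` [set z | adjoin 1 V (y i0 ^+ Q) (z ^+ Q)] by apply.
    apply: lincomb_min; first exact: submod_preim_pow.
    move=> i _ /=; have [->|ii0] := eqVneq i i0; first exact: mem_adjoin.
    apply: (sub_adjoin D1); apply: (mem_adjoins D1 N0sub); apply/mapP;
      exists i => //.
    by rewrite mem_enum.
  (* Thus [n a (e+1) + a e <= n lam]; eliminating [lam] with [lam_le] gives the inequality whose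
     limit is absurd. *)
  have : (a e.+1 * n <= size s * lam + (lam - a e))%N.
    apply: leN0; apply: chainSr (chain_bracket (free e.+1) M2sub chM2) _ mU.
    exact: ideal_sub_submod.
  move: ae_lam lam_le size_s; rewrite -/Q.
  move: (size s) (a e) (a e.+1) (Q ^ d)%N => k ae ae' Qd ae_lam lam_le <-.
  by nia.
have := copies_limit lim1 le; lia.
Qed.

(** Lech's argument gives [R / m^[p]] length at least [p^n], whereas signature one allows at most
    [p^d]. *)
Lemma embedding_dim_le : (n <= d)%N.
Proof.
have [msub m1 _] := mloc; have p_gt0 := ltnW p_gt1.
have y1 : ~ lincomb predT y 1 by rewrite -ym.
have ch := chain_lech p_gt0 y1 bracket_generators_independent.
rewrite -(leq_exp2l _ _ p_gt1); apply: colength_bracket_p.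
apply: chainSl ch _; apply: bracket_min => [|z]; first exact: submod_lincomb.
rewrite ym; have pD : additive_pow R p by have := D 1; rewrite expn1.
suff : lincomb predT y `<=` [set z | lincomb predT (fun i =>
  y i ^+ p) (z ^+ p)] by apply.
apply: lincomb_min; first exact: submod_preim_pow pD (submod_lincomb _ _).
by move=> i _ /=; apply: (@mem_lincomb _ _ predT (fun i => y i ^+ p)).
Qed.

End Relation.
End RegularSequence.
End SignatureOne.

End Forward.

(** * Cohen-Macaulay rings *)

Section CohenMacaulay.
Context {R : comNzRingType} (p : nat) (charRp : p \in [pchar R]) (m : set R).
Context (noethR : noetherian R) (mloc : local_ideal m).
Context (perf : perfect_residue_field m p).
Let D1 := additive_pow1 R.

Lemma krull_dim_unique d d' : krull_dim R d -> krull_dim R d' -> d = d'.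
Proof.
move=> [[P Pch] le] [[P' P'ch] le']; apply/eqP; rewrite eqn_leq.
by rewrite (le' _ _ Pch) (le _ _ P'ch).
Qed.

Lemma regular_sequence_mod (s : seq R) :
  regular_sequence s -> regular_mod [set 0] s.
Proof.
case=> reg _.
have {reg} : forall i y, (i < size s)%N ->
    adjoins 1 [set 0] (take i s) (s`_i * y) -> adjoins 1 [set 0] (take i s) y.
  by move=> i y; rewrite -ideal_genE; apply: reg.
elim: s [set 0 : R] => //= a s IHs I reg; split.
  by move=> x; apply: (reg 0%N).
by apply: IHs => i y; apply: (reg i.+1).
Qed.

Lemma parameters_ex : cohen_macaulay m -> exists s l,
  [/\ krull_dim R (size s), {in s, forall x, m x}, regular_mod [set 0] s,
      length_le 1 (adjoins 1 [set 0] s) setT l.+1 &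
      chain 1 (adjoins 1 [set 0] s) setT l.+1].
Proof.
case=> d [dimR [[s [size_s sm reg]] _]]; rewrite -size_s in dimR.
have [msub m1 _] := mloc; have [n len] :=
  finite_colength noethR mloc dimR reg sm.
have Xsub := submod_adjoins D1 s (submod_0 1).
have [l [lel chl]] := colength_exact D1 Xsub len.
have chm : chain 1 (adjoins 1 [set 0] s) setT 1.
  apply: chainS (chain0 msub _) (submodT 1) _; last by split=> // /(_ 1 I).
  by apply: adjoins_min => // _ ->; exact: (submod0 msub).
exists s, l.-1; rewrite prednK; last exact: lel.
by split=> //; exact: regular_sequence_mod.
Qed.

(** [M2] plays the role of [m^2]. If [m / m^2] had length below [n], lifting its generators by
    Nakayama's lemma would generate [m] by fewer than [n] elements. *)
Lemma minimal_generators_chain n (M2 : set R) : submod 1 M2 ->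
  (forall A, submod 1 A -> (forall z w,
    m z -> m w -> A (z * w)) -> M2 `<=` A) ->
  M2 `<=` m -> (forall s, m = adjoins 1 [set 0] s -> (n <= size s)%N) ->
  chain 1 M2 m n.
Proof.
have [msub _ _] := mloc; move=> M2sub M2min M2m nmin.
case: n nmin => [|n] nmin; first exact: chain0.
suff nle : ~ length_le 1 M2 m n.
  apply: contrapT => nch; apply: nle => k chk; rewrite leqNgt; apply/negP => nk.
  by apply: nch; apply: chain_leq chk.
move=> /(generators_of_length D1 msub M2sub M2m)[s [size_s sm ms]].
have [t mt] := noetherian_gen noethR msub.
have Wsub := submod_adjoins D1 s (submod_0 1).
have mW : m `<=` adjoins 1 [set 0] s.
  apply: (nakayama mloc (s := t) D1 Wsub) => [x xt|x|N Nsub WN mN].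
  - by rewrite mt; apply: (mem_adjoins D1 (submod_0 1)).
  - by rewrite {1}mt; apply: adjoinsS => _ ->; exact: (submod0 Wsub).
  - apply: subset_trans ms _; apply: adjoins_min => //.
      exact: M2min.
    by move=> u us; apply: WN; apply: (mem_adjoins D1 (submod_0 1)).
have := nmin s; rewrite leqNgt ltnS size_s => /(_ _)/notF; apply.
apply/seteqP; split=> //; apply: adjoins_min => // _ ->.
exact: (submod0 msub).
Qed.

Lemma minimal_generators_ex : exists ys, m = adjoins 1 [set 0] ys /\
  forall s, m = adjoins 1 [set 0] s -> (size ys <= size s)%N.
Proof.
have [msub _ _] := mloc; have [t mt] := noetherian_gen noethR msub.
have ex : exists n, `[< exists s, size s = n /\ m = adjoins 1 [set 0] s >].
  by exists (size t); apply/asboolP; exists t.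
case: (ex_minnP ex) => n /asboolP[ys [<- mys]] nmin; exists ys; split=> // s ms.
by apply: nmin; apply/asboolP; exists s.
Qed.

Lemma regular_of_signature_one (K : realType) a d : cohen_macaulay m ->
  krull_dim R d -> (forall e, ring_copies (qroots charRp e) (a e)) ->
  (fun e : nat => (a e)%:R / ((p ^ e)%N%:R ^+ d) : K) @ \oo --> (1 : K) ->
  regular_local m.
Proof.
move=> CM dimR copies lim1; have [msub m1 _] := mloc.
have free e := free_summand_qroots (copies e).
have ge := generators_ge charRp mloc perf free lim1.
have [xs [l [dimxs xsm _ lel chl]]] := parameters_ex CM.
have dE := krull_dim_unique dimR dimxs.
have [ys [mys ysmin]] := minimal_generators_ex.
pose M2 := [set x | forall A, submod 1 A ->
  (forall z w, m z -> m w -> A (z * w)) -> A x].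
have M2sub : submod 1 M2.
  split=> [A Asub _|c x y M2x M2y A Asub mA]; first exact: (submod0 Asub).
  by apply: (submodD Asub); [apply: submodMl => //; apply: M2x | apply: M2y].
have chM2 : chain 1 M2 m (size ys).
  apply: minimal_generators_chain ysmin => // [A Asub mA x|x]; first exact.
  by apply=> // z w _ mw; apply: submodMl.
have leX e : length_le (p ^ e) (bracket (p ^ e) (adjoins 1 [set 0] xs)) setT
    ((p ^ e) ^ d * l.+1).
  by rewrite dE; apply: (length_le_bracket_adjoins charRp mloc perf lel).
have Xm : adjoins 1 [set 0] xs `<=` m.
  by apply: adjoins_min => // _ ->; exact: (submod0 msub).
have Xsub := submod_adjoins D1 xs (submod_0 1).
have ym : m = lincomb predT (fun i : 'I_(size ys) => ys`_i).
  by rewrite {1}mys -ideal_genE.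
have le_d : (size ys <= d)%N.
  apply: (embedding_dim_le charRp mloc free lim1 Xsub Xm leX chl ym M2sub _ chM2).
  by move=> z w mz mw A _; apply.
exists d; split=> //; split=> [|s]; last by rewrite ideal_genE; apply: ge.
exists ys; rewrite ideal_genE; split=> //.
by apply/eqP; rewrite eqn_leq le_d ge.
Qed.

(** Generating [m] by [d] elements bounds the length of [R / m^[q]] above by [q^d]. For the lower
    bound, [R / X^[q]], with [X] the ideal of the regular sequence [xs], has length at least
    [q^d (l + 1)] and at most [l + 1] times that of [R / m^[q]]. *)
Lemma ring_copies_regular a d e : F_finite R p -> cohen_macaulay m ->
  regular_local m -> krull_dim R d -> ring_copies (qroots charRp e) a ->
  a = ((p ^ e) ^ d)%N.
Proof.
move=> Ffin CM [d' [dimR' [[ys [size_ys mys]] _]]] dimR.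
have {d' dimR'} size_ys : size ys = d by rewrite size_ys (krull_dim_unique dimR dimR').
have [xs [l [dimxs xsm reg lel chl]]] := parameters_ex CM.
have dE := krull_dim_unique dimR dimxs.
have D f := additive_pow_pchar charRp f; have [msub m1 _] := mloc.
have Xsub := submod_adjoins D1 xs (submod_0 1).
apply: (ring_copies_qroots mloc noethR Ffin) => [f t let'|f].
  have := length_le_bracket mloc (D f) Xsub lel let'.
  have ch := chain_regular_mod (p ^ f) (submod_0 1) reg chl.
  have sub : bracket (p ^ f) (adjoins 1 [set 0] xs) `<=`
      adjoins 1 [set 0] [seq x ^+ (p ^ f) | x <- xs].
    apply: subset_trans (@bracket_adjoins R (p ^ f) [set 0] xs (D f)) _;
      apply: adjoinsS.
    by apply: bracket0; rewrite expn_gt0 (ltnW (pchar_gt1 charRp)).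
  move=> /(_ _ (chainSl (ideal_chain (p ^ f) ch) sub)).
  by rewrite -dE mulnC leq_pmul2l.
have := @length_le_bracket_adjoins _ _ charRp _ mloc perf f ys 1.
rewrite -ideal_genE -mys size_ys muln1; apply.
exact: (length_le_residue mloc D1 (residue_perfect1 msub)).
Qed.

End CohenMacaulay.

Theorem corollary16 (R : comNzRingType) (m : set R) (p : nat)
    (charRp : p \in [pchar R])
    (noethR : noetherian R) (localR : local_ring m) (reducedR : reduced R)
    (FfinR : F_finite R p) (CMR : cohen_macaulay m)
    (perfR : perfect_residue_field m p)
    (K : realType) (s : K) (hs : is_F_signature charRp s) :
  s = 1 <-> regular_local m.
Proof.
have mloc := local_ring_local_ideal localR.
case: hs => d [a [dimR copies lims]]; split=> [s1|regR].
  rewrite s1 in lims.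
  exact: (regular_of_signature_one noethR mloc perfR CMR dimR copies lims).
have aE e := ring_copies_regular noethR mloc perfR FfinR CMR regR dimR (copies e).
have p_gt0 := ltnW (pchar_gt1 charRp).
have lim1 : (fun e : nat =>
  (a e)%:R / ((p ^ e)%N%:R ^+ d) : K) @ \oo --> (1 : K).
  rewrite (_ : (fun _ => _) = cst 1); first exact: cvg_cst.
  apply/funext => e; rewrite aE natrX divff // expf_neq0 //.
  by rewrite pnatr_eq0 -lt0n expn_gt0 p_gt0.
exact: (cvg_unique _ lims lim1).
Qed.
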